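(* Let $n\ge 1$ and let $T$ be a rhombus tiling of the zonogon $Z_n$. Then the set $\Sigma(T)$ of linear orders on $[n]$ compatible with $T$ is a complete Condorcet domain.
   Context: Linear orders. $[n]=\{1,\dots,n\}$, and $\mathcal L([n])$ is the set of linear orders on $[n]$. A linear order $x_1<\dots<x_n$ is encoded by the word $x_1\dots x_n$ ($x_1$ is the least, or worst, element and $x_n$ the greatest, or best). $\alpha$ denotes the order $1<2<\dots<n$ and $\omega$ the order $n<n-1<\dots<1$. Condorcet domains. A set $\mathcal D\subseteq\mathcal L([n])$ is cyclic if there exist three elements $i,j,k$ of $[n]$ and three linear orders in $\mathcal D$ whose restrictions to $\{i,j,k\}$ are of the form $\{ijk,jki,kij\}$ or $\{kji,jik,ikj\}$. A Condorcet domain (CD) is a set of linear orders that is not cyclic. All domains considered contain both $\alpha$ and $\omega$. A Condorcet domain is complete if it is inclusion-wise maximal, i.e. adding any new linear order to it would make it cyclic. Rhombus tilings. In the upper half-plane $\mathbb R\times\mathbb R_{>0}$ fix $n$ vectors $\xi_1,\dots,\xi_n$ of the same length and with distinct directions, going in this order clockwise around $(0,0)$. The zonogon is $Z_n=\{\sum_i a_i\xi_i: 0\le a_i\le 1\}$; its bottom vertex is $(0,0)$ and its top vertex is $\xi_1+\dots+\xi_n$. For $i<j$, an $ij$-tile is a translate of the rhombus $[0,\xi_i]+[0,\xi_j]$. A rhombus tiling $T$ of $Z_n$ is a subdivision of $Z_n$ into such tiles in which any two intersecting tiles meet in a single vertex or a single closed edge. $G_T$ is the planar directed graph formed by the vertices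 and edges of the tiles, with edges directed upward; an edge that is a translate of $[0,\xi_i]$ has color $i$. (For $n=1$, $Z_1$ is the segment $[0,\xi_1]$ and $G_T$ is a single edge.) A snake of $T$ is a directed path in $G_T$ from the bottom vertex to the top vertex of $Z_n$. It is known that each snake has exactly $n$ edges, one of each color, so the sequence of edge colors along it (from bottom to top) is a linear order on $[n]$, the first color being the least element. A linear order obtained in this way is called compatible with $T$, and $\Sigma(T)$ is the set of all linear orders compatible with $T$. *)

(* Defs.v *)
From HB Require Import structures.
From mathcomp Require Import all_boot all_order all_algebra.
From mathcomp Require Import boolp classical_sets functions cardinality reals.

Set Implicit Arguments.
Unset Strict Implicit.
Unset Printing Implicit Defensive.

Import Order.TTheory GRing.Theory Num.Theory.
Local Open Scope classical_set_scope.
Local Open Scope ring_scope.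

(** * Linear orders and Condorcet domains *)

(* A linear order is encoded by its word, least (worst) element first; the
   ground set [n] = {1, ..., n} is 'I_n, so that i : 'I_n stands for i + 1. *)
Definition linorder (n : nat) := {w : n.-tuple 'I_n | uniq w}.

Definition word (n : nat) (x : linorder n) : seq 'I_n := val (val x).

Lemma alpha_uniq (n : nat) : uniq (ord_tuple n).
Proof. by rewrite val_ord_tuple; exact: enum_uniq. Qed.

Lemma omega_uniq (n : nat) : uniq (rev_tuple (ord_tuple n)).
Proof. by rewrite /= rev_uniq; exact: alpha_uniq. Qed.

(* alpha is 1 < 2 < ... < n and omega is n < n-1 < ... < 1. *)
Definition alpha (n : nat) : linorder n :=
  exist (fun w : n.-tuple 'I_n => uniq w) (ord_tuple n) (alpha_uniq n).

Definition omega (n : nat) : linorder n :=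
  exist (fun w : n.-tuple 'I_n => uniq w) (rev_tuple (ord_tuple n))
    (omega_uniq n).

Definition order_restriction (n : nat) (A : seq 'I_n) (x : linorder n) :
    seq 'I_n :=
  [seq a <- word x | a \in A].

Definition cyclic_domain (n : nat) (D : set (linorder n)) : Prop :=
  exists i j k : 'I_n, uniq [:: i; j; k] /\
  exists x y z : linorder n, [/\ D x, D y & D z] /\
    let r := order_restriction [:: i; j; k] in
    [/\ r x = [:: i; j; k], r y = [:: j; k; i] & r z = [:: k; i; j]] \/
    [/\ r x = [:: k; j; i], r y = [:: j; i; k] & r z = [:: i; k; j]].

(* Domains are required throughout to contain alpha and omega. *)
Definition condorcet_domain (n : nat) (D : set (linorder n)) : Prop :=
  [/\ D (alpha n), D (omega n) & ~ cyclic_domain D].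

Definition complete_condorcet_domain (n : nat) (D : set (linorder n)) : Prop :=
  condorcet_domain D /\
  forall x : linorder n, ~ D x -> cyclic_domain (x |` D).

(** * Zonogons and rhombus tilings *)

Section Tilings.
Variables (R : realType) (n : nat).

Local Notation plane := 'rV[R]_2.

(* The library norm on 'rV[R]_2 is the sup norm, hence this definition. *)
Definition eucl_length (p : plane) : R := Num.sqrt (p 0 0 ^+ 2 + p 0 1 ^+ 2).

(* For p and q in the open upper half-plane: the direction of q is obtained
   from that of p by a clockwise rotation of angle in ]0, pi[. *)
Definition clockwise (p q : plane) : Prop :=
  p 0 0 * q 0 1 - p 0 1 * q 0 0 < 0.

Definition zonogon_vectors (xi : 'I_n -> plane) : Prop :=
  [/\ forall i, 0 < xi i 0 1,
      forall i j, eucl_length (xi i) = eucl_length (xi j)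
    & forall i j : 'I_n, (i < j)%N -> clockwise (xi i) (xi j)].

Variable xi : 'I_n -> plane.

Definition zonogon : set plane :=
  [set p | exists2 a : 'I_n -> R, forall i, 0 <= a i <= 1
           & p = \sum_i a i *: xi i].

Definition zonogon_top : plane := \sum_i xi i.

(* Tile i j p stands for the rhombus p + [0, xi i] + [0, xi j]; the condition
   i < j is imposed in rhombus_tiling. *)
Record tile := Tile { tile_lo : 'I_n; tile_hi : 'I_n; tile_base : plane }.

Definition tile_region (t : tile) : set plane :=
  [set p | exists a b : R, [/\ 0 <= a <= 1, 0 <= b <= 1
     & p = tile_base t + a *: xi (tile_lo t) + b *: xi (tile_hi t)]].

Definition tile_vertices (t : tile) : set plane :=
  let: Tile i j p := t in
  [set p; p + xi i; p + xi j; p + xi i + xi j].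

(* (p, k) stands for the edge of color k from p up to p + xi k. *)
Definition edge : Type := plane * 'I_n.

Definition edge_region (e : edge) : set plane :=
  [set p | exists2 a : R, 0 <= a <= 1 & p = e.1 + a *: xi e.2].

Definition tile_edges (t : tile) : set edge :=
  let: Tile i j p := t in
  [set (p, i); (p, j); (p + xi j, i); (p + xi i, j)].

(* When n = 1 the zonogon is a segment, and its only tiling has no tiles. *)
Definition rhombus_tiling (T : set tile) : Prop :=
  [/\ finite_set T,
      forall t, T t -> (tile_lo t < tile_hi t)%N,
      (1 < n)%N -> \bigcup_(t in T) tile_region t = zonogon
    & forall t t', T t -> T t' -> t <> t' ->
        [\/ tile_region t `&` tile_region t' = set0,
            exists2 v, (tile_vertices t `&` tile_vertices t') v
              & tile_region t `&` tile_region t' = [set v]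
          | exists2 e, (tile_edges t `&` tile_edges t') e
              & tile_region t `&` tile_region t' = edge_region e]].

(* Edges of the graph G_T; the second case is its single edge for n = 1. *)
Definition graph_edges (T : set tile) : set edge :=
  [set e | (exists2 t, T t & tile_edges t e) \/ (n = 1%N /\ e.1 = 0)].

Fixpoint directed_path (G : set edge) (p : plane) (s : seq edge) (q : plane)
  : Prop :=
  if s is e :: s' then
    [/\ e.1 = p, G e & directed_path G (p + xi e.2) s' q]
  else p = q.

Definition snake (T : set tile) (s : seq edge) : Prop :=
  directed_path (graph_edges T) 0 s zonogon_top.

(* Sigma(T). *)
Definition compatible_orders (T : set tile) : set (linorder n) :=
  [set x | exists2 s, snake T s & [seq e.2 | e <- s] = word x].

End Tilings.

(* Main.v *)
Require Import Defs.
From mathcomp Require Import all_boot all_order all_algebra.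
From mathcomp Require Import boolp classical_sets functions cardinality reals.
From mathcomp Require Import zify ring lra.

(** A snake is encoded by the word of its colors.  The left boundary of the
zonogon is the snake alpha.  As long as a snake is not omega, some tile has both
of its left edges on it, so that two consecutive colors i < j of the word can be
swapped by pushing the snake across that tile ([flip_or_inverted]).  Hence the
tiling is swept by snakes alpha = W 0, ..., W N = omega, any two colors are swapped
exactly once, at their [flip_time], and for i < j < k the flip times of the pairs
ij, ik, jk are either increasing or decreasing ([flip_time_between]).

An order is called obedient if, on every triple of colors, the pairs that it
inverts are the first ones of the triple to be flipped.  On a triple i < j < k the
sweep realizes four orders; these are all the obedient ones, and j is never the
greatest of the three or never the least.  So the obedient orders are not cyclic
([obedient_acyclic]), and a disobedient order forms a cyclic triple with two
snakes of the sweep ([disobedient_cyclic]).  It remains to see that the compatible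
orders are exactly the obedient ones.

An obedient order x is compatible ([obedient_ind]): follow the sweep, but perform
only the flips of the pairs inverted by x.  When such a pair comes up, obedience
forces all earlier flips that involve one of its colors and a third one to agree
with those of the sweep, so the current snake goes through the very tile that the
sweep crosses at that time.

A compatible order y is obedient because its initial segments are, as sets,
initial segments of snakes of the sweep ([prefix_swept]), and obedience can be read
off these sets ([obedient_of_prefixes]).  Two geometric facts are behind this.  Each
tile is crossed by the sweep ([tile_swept]), so each edge of y lies on some W m.
And a vertex of the tiling is reached through the same set of colors by all W m
that contain it ([vertex_label_uniq]): different sets of colors may well have the
same vector sum, but the snakes W m move to the right, so that a vertex which the
sweep has passed is never met again.

The planar geometry needed is limited to one argument, used several times: a point
that can be moved to the right inside the zonogon has a tile immediately to its
right. *)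

Set Implicit Arguments.
Unset Strict Implicit.
Unset Printing Implicit Defensive.

Import Order.TTheory GRing.Theory Num.Theory.

(** * Words, inversions and adjacent swaps *)

Section Words.
Variable n : nat.
Implicit Types (w x y s : seq 'I_n) (a b c i j k : 'I_n).

(** Words are handled as plain sequences, so that they can be cut and
reassembled freely; [is_order_word] goes back to linear orders. *)
Definition is_order w := perm_eq w (enum 'I_n).

Definition before w a b := index a w < index b w.

(** Being inverted is symmetric in a and b for a != b ([invertedC]), which is
why pairs of colors need not be sorted below. *)
Definition inverted w a b := before w a b != (a < b).

Lemma is_order_uniq w : is_order w -> uniq w.
Proof. by move=> /perm_uniq ->; exact: enum_uniq. Qed.

Lemma is_order_mem w a : is_order w -> a \in w.
Proof. by move=> /perm_mem ->; rewrite mem_enum. Qed.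

Lemma is_orderP w : reflect (uniq w /\ size w = n) (is_order w).
Proof.
apply: (iffP idP) => [ow | [uw sw]].
  by rewrite (is_order_uniq ow) (perm_size ow) size_enum_ord.
apply: (uniq_perm uw (enum_uniq _)).
apply: (uniq_min_size uw _ _).2 => [a _|]; first by rewrite mem_enum.
by rewrite sw size_enum_ord.
Qed.

Lemma index_neq w a b : is_order w -> a != b -> index a w <> index b w.
Proof.
move=> ow /eqP nab e; apply: nab.
by apply: (index_inj a _ _ e); exact: is_order_mem.
Qed.

Lemma beforeN w a b : is_order w -> a != b -> before w b a = ~~ before w a b.
Proof. by rewrite /before => ow /(index_neq ow); lia. Qed.

Lemma ord_ltnN a b : a != b -> (b < a) = ~~ (a < b).
Proof. by rewrite -val_eqE /=; lia. Qed.

Lemma before_enum a b : before (enum 'I_n) a b = (a < b).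
Proof. by rewrite /before !index_enum_ord. Qed.

Lemma invertedC w a b : is_order w -> a != b -> inverted w b a = inverted w a b.
Proof.
by move=> ow ab; rewrite /inverted (beforeN ow ab) (ord_ltnN ab);
  do 2!case: (_ < _); case: before.
Qed.

Lemma beforeE w a b : before w a b = inverted w a b (+) (a < b).
Proof. by rewrite /inverted; case: before; case: (_ < _). Qed.

(** Turns statements about the set of letters read before j into
statements about the order. *)
Lemma mem_prefix s1 s2 a j :
  is_order (s1 ++ j :: s2) -> (a \in s1) = before (s1 ++ j :: s2) a j.
Proof.
move=> /is_order_uniq; rewrite cat_uniq /= negb_or.
case/and3P=> _ /andP[js1 _] _.
rewrite /before !index_cat (negPf js1) /= eqxx addn0.
by case: ifP => [|_]; [rewrite index_mem | lia].
Qed.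

Lemma index_adjacent s1 i j s2 a : uniq (s1 ++ i :: j :: s2) ->
  index a (s1 ++ i :: j :: s2) =
    if a == i then size s1 else if a == j then (size s1).+1 else
    if a \in s1 then index a s1 else (size s1).+2 + index a s2.
Proof.
rewrite cat_uniq /= => /and3P[_ /norP[is1 /norP[js1 _]] _].
rewrite index_cat /= (eq_sym i a) (eq_sym j a).
have [->|ai] := eqVneq a i; first by rewrite (negPf is1) addn0.
have [->|aj] := eqVneq a j; first by rewrite (negPf js1) addn1.
by case: ifP => // _; rewrite !addnS.
Qed.

Lemma swap_is_order s1 i j s2 :
  is_order (s1 ++ j :: i :: s2) = is_order (s1 ++ i :: j :: s2).
Proof.
have /permPl h : perm_eq (s1 ++ j :: i :: s2) (s1 ++ i :: j :: s2).
  by rewrite perm_cat2l (perm_catCA [:: j] [:: i] s2).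
exact: h.
Qed.

Lemma swap_before s1 i j s2 a b : is_order (s1 ++ i :: j :: s2) -> a != b ->
  before (s1 ++ j :: i :: s2) a b =
    if ((a == i) && (b == j)) || ((a == j) && (b == i))
    then ~~ before (s1 ++ i :: j :: s2) a b
    else before (s1 ++ i :: j :: s2) a b.
Proof.
move=> ow ab; have uw := is_order_uniq ow.
have uw' : uniq (s1 ++ j :: i :: s2).
  by apply: is_order_uniq; rewrite swap_is_order.
have ij : i != j.
  move: uw; rewrite cat_uniq => /and3P[_ _ /= /andP[+ _]].
  by rewrite inE negb_or => /andP[].
rewrite /before !index_adjacent //.
have szi c : c \in s1 -> index c s1 < size s1 by rewrite index_mem.
move/eqP: ab => ab; move/eqP: ij => ij.
case: (boolP (a \in s1)) => [/szi ha|_]; case: (boolP (b \in s1)) => [/szi hb|_];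
case: (eqVneq a i) => [ai|_]; case: (eqVneq a j) => [aj|_];
case: (eqVneq b i) => [bi|_]; case: (eqVneq b j) => [bj|_] /=;
first [congruence | lia].
Qed.

(** A swap of an ascent inverts this one pair and changes no other
pair: this makes the sweep monotone. *)
Lemma swap_inverted s1 i j s2 a b :
  is_order (s1 ++ i :: j :: s2) -> i < j -> a != b ->
  inverted (s1 ++ j :: i :: s2) a b =
    inverted (s1 ++ i :: j :: s2) a b
      || ((a == i) && (b == j)) || ((a == j) && (b == i)).
Proof.
move=> ow ij ab; rewrite /inverted swap_before //.
have bij : before (s1 ++ i :: j :: s2) i j.
  have : i \in s1 ++ [:: i] by rewrite mem_cat inE eqxx orbT.
  by rewrite (@mem_prefix _ s2 i j) -catA.
have bji : before (s1 ++ i :: j :: s2) j i = false.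
  by apply/negbTE; rewrite -beforeN // eq_sym -val_eqE /= neq_ltn ij.
case: (boolP ((a == i) && (b == j))) => [/andP[/eqP-> /eqP->]|_] /=.
  by rewrite bij ij.
case: (boolP ((a == j) && (b == i))) => [/andP[/eqP-> /eqP->]|_] /=.
  by rewrite bji /= orbT ltnNge ltnW.
by rewrite !orbF.
Qed.

Lemma flip_inverted_pair s1 i j s2 :
  is_order (s1 ++ i :: j :: s2) -> i < j ->
  inverted (s1 ++ i :: j :: s2) i j = false.
Proof.
move=> ow ij; rewrite /inverted ij.
have : i \in s1 ++ [:: i] by rewrite mem_cat inE eqxx orbT.
by rewrite (@mem_prefix _ s2 i j) -catA // => ->.
Qed.

Lemma before_sorted w : is_order w -> sorted (before w) w.
Proof.
move=> /is_order_uniq uw; case: w uw => // d w uw.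
apply/(sortedP d) => i si; rewrite /before !index_uniq //.
exact: ltnW.
Qed.

Lemma before_trans w : transitive (before w).
Proof. by move=> b a c; exact: ltn_trans. Qed.

(** A word is sorted for its own order, hence determined by it. *)
Lemma before_inj x y : is_order x -> is_order y ->
  (forall a b, before x a b = before y a b) -> x = y.
Proof.
move=> ox oy e; apply: (irr_sorted_eq (@before_trans x)).
- by move=> a; rewrite /before ltnn.
- exact: before_sorted.
- by rewrite (eq_sorted e); exact: before_sorted.
- by move=> a; rewrite !is_order_mem.
Qed.

(** Two letters are consecutive as soon as no third letter separates
them; this is how an occurrence of the two letters is recovered from comparisons. *)
Lemma cat_of_adjacent w i j : is_order w -> i != j -> before w i j ->
    (forall c, c != i -> c != j -> before w i c = before w j c) ->
  exists s1 s2, w = s1 ++ i :: j :: s2.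
Proof.
move=> ow ij bij h.
have [s1 [t ew]] : exists s1 t, w = s1 ++ i :: t.
  by case/splitPr: (is_order_mem i ow) => p1 p2; exists p1, p2.
have js1 : j \notin s1.
  by rewrite (@mem_prefix s1 t j i) -?ew // (beforeN ow ij) bij.
have jt : j \in t.
  have := is_order_mem j ow.
  by rewrite ew mem_cat (negPf js1) inE eq_sym (negPf ij).
case: t ew jt => // c t ew _; exists s1, t.
have [<- //|cj] := eqVneq c j.
have ew' : w = (s1 ++ [:: i]) ++ c :: t by rewrite ew -catA.
have ic : before w i c.
  by rewrite ew' -mem_prefix -?ew' // mem_cat inE eqxx orbT.
have ci : c != i.
  by apply: contraTneq ic => ->; rewrite /before ltnn.
have := h c ci cj; rewrite ic ew' -mem_prefix -?ew' //.
by rewrite mem_cat inE (negPf js1) eq_sym (negPf ij).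
Qed.

Lemma inverted_of_sorted w a b : is_order w ->
  sorted (fun i j => j <= i) w -> a != b -> inverted w a b.
Proof.
move=> ow sw ab; rewrite /inverted.
have le c d : before w c d -> d <= c.
  have tr : transitive (fun i j : 'I_n => j <= i).
    by move=> y x z h1 h2; exact: leq_trans h2 h1.
  by move=> bcd; apply: (sorted_ltn_index tr sw) => //; exact: is_order_mem.
have [bab|bba] := boolP (before w a b); first by rewrite ltnNge le.
rewrite -beforeN // in bba.
by rewrite ltn_neqAle ab le.
Qed.

Lemma inverted_rev_enum a b : a != b -> inverted (rev (enum 'I_n)) a b.
Proof.
apply: inverted_of_sorted; first by rewrite /is_order perm_rev.
rewrite rev_sorted; apply: sub_sorted (before_sorted (perm_refl (enum 'I_n))).
by move=> i j; rewrite before_enum => /ltnW.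
Qed.

End Words.

(** * Sweeps and obedient orders *)

Section Sweeps.
Variables (n : nat) (E : seq 'I_n -> 'I_n -> 'I_n -> Prop).
Implicit Types (w x y s : seq 'I_n) (a b c i j k : 'I_n).

(** [E s i j] stands for the presence of an ij-tile at the vertex reached by the
word s; nothing else about the tiling is used in this part. *)
Definition flip w w' := exists s1 i j s2,
  [/\ i < j, E s1 i j, w = s1 ++ i :: j :: s2 & w' = s1 ++ j :: i :: s2].

Definition sweep N (W : nat -> seq 'I_n) :=
  [/\ W 0 = enum 'I_n, forall m, m < N -> flip (W m) (W m.+1)
    & forall a b, a != b -> inverted (W N) a b].

Lemma flip_is_order w w' : flip w w' -> is_order w -> is_order w'.
Proof. by move=> [s1 [i [j [s2 [_ _ -> ->]]]]]; rewrite swap_is_order. Qed.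

Lemma no_flip_inverted w w' :
  is_order w -> (forall a b, a != b -> inverted w a b) -> ~ flip w w'.
Proof.
move=> ow inv [s1 [i [j [s2 [ij _ e _]]]]].
have := inv i j; rewrite e flip_inverted_pair -?e //.
by rewrite -val_eqE /= neq_ltn ij; move=> /(_ isT).
Qed.

(** Each flip decreases the number of pairs that are not inverted. *)
Lemma sweep_exists (P : seq 'I_n -> Prop) :
    P (enum 'I_n) ->
    (forall w w', P w -> flip w w' -> P w') ->
    (forall w, is_order w -> P w ->
       (exists w', flip w w') \/ (forall a b, a != b -> inverted w a b)) ->
  exists N W, sweep N W /\ forall m, m <= N -> P (W m).
Proof.
move=> P0 Pflip Pnext.
pose mu w := #|[set p : 'I_n * 'I_n | (p.1 != p.2) && ~~ inverted w p.1 p.2]|.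
have main : forall M w, mu w < M -> is_order w -> P w -> exists N W,
    [/\ W 0 = w, forall m, m < N -> flip (W m) (W m.+1),
        forall a b, a != b -> inverted (W N) a b
      & forall m, m <= N -> P (W m)].
  elim=> // M IH w hM ow Pw.
  have [[w' ww']|inv] := Pnext w ow Pw; last first.
    by exists 0, (fun=> w); split.
  have muw' : mu w' < M.
    apply: (leq_trans _ (hM : mu w <= M)); apply: proper_card.
    have [s1 [i [j [s2 [ij _ e e']]]]] := ww'.
    have nij : i != j by rewrite -val_eqE /= neq_ltn ij.
    rewrite e in ow; apply/properP; split.
      apply/fintype.subsetP=> p; rewrite !inE => /andP[np]; rewrite e' e np /=.
      by rewrite swap_inverted // !negb_or => /andP[/andP[]].
    exists (i, j); rewrite !inE /= nij /=; first by rewrite e flip_inverted_pair.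
    by rewrite e' swap_inverted // !eqxx orbT.
  have [N [W [W0 Ws WN PW]]] := IH w' muw' (flip_is_order ww' ow) (Pflip _ _ Pw ww').
  exists N.+1, (fun m => if m is m'.+1 then W m' else w); split => //.
  - by case=> [_|m]; [rewrite W0 | exact: Ws].
  - by case=> [|m] // /PW.
have [N [W [W0 Ws WN PW]]] := main _ _ (ltnSn _) (perm_refl _) P0.
by exists N, W.
Qed.

Variables (N : nat) (W : nat -> seq 'I_n).
Hypothesis sweepW : sweep N W.

Lemma sweep_is_order m : m <= N -> is_order (W m).
Proof.
case: sweepW => W0 Ws _; elim: m => [|m IH] mN; first by rewrite W0 /is_order.
by apply: flip_is_order (Ws m mN) _; exact/IH/ltnW.
Qed.

Lemma sweep_inverted_mono m m' a b : a != b -> m <= m' -> m' <= N ->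
  inverted (W m) a b -> inverted (W m') a b.
Proof.
move=> ab; elim: m' => [|m' IH]; first by rewrite leqn0 => /eqP ->.
rewrite leq_eqVlt => /orP[/eqP -> //|mm' m'N inv].
have om := sweep_is_order (ltnW m'N).
case: sweepW => _ /(_ m' m'N)[s1 [i [j [s2 [ij _ e ->]]]]] _.
by rewrite swap_inverted -?e // IH // ltnW.
Qed.

(** A pair that is inverted stays so, hence the inverted pairs of W m are
those with flip time at most m ([inverted_sweep]). *)
Definition flip_time a b := find (fun m => inverted (W m) a b) (iota 0 N.+1).

Lemma inverted_sweep m a b : a != b -> m <= N ->
  inverted (W m) a b = (flip_time a b <= m).
Proof.
move=> ab mN.
have has_inv : has (fun m => inverted (W m) a b) (iota 0 N.+1).
  apply/hasP; exists N; first by rewrite mem_iota /=.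
  by case: sweepW => _ _; exact.
have tN : flip_time a b < N.+1.
  by rewrite -[X in _ < X](size_iota 0) -has_find.
have invt : inverted (W (flip_time a b)) a b.
  by have := nth_find 0 has_inv; rewrite nth_iota.
apply/idP/idP => [|tm]; last exact: sweep_inverted_mono invt.
apply: contraTT; rewrite -ltnNge => mt; apply/negbT.
by have := before_find 0 mt; rewrite nth_iota ?add0n // => ->.
Qed.

Lemma flip_time_bounds a b : a != b -> 0 < flip_time a b <= N.
Proof.
move=> ab; case: sweepW => W0 _ WN.
rewrite -(inverted_sweep ab (leqnn N)) WN // andbT ltnNge.
by rewrite -(inverted_sweep ab (leq0n N)) W0 /inverted before_enum eqxx.
Qed.

Lemma flip_timeC a b : flip_time a b = flip_time b a.
Proof.
have [->//|ab] := eqVneq a b.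
apply: eq_in_find => m; rewrite mem_iota => /andP[_ mN].
by rewrite invertedC //; [exact: sweep_is_order | rewrite eq_sym].
Qed.

Lemma flip_time_step m s1 i j s2 a b : m < N -> i < j ->
  W m = s1 ++ i :: j :: s2 -> W m.+1 = s1 ++ j :: i :: s2 -> a != b ->
  (flip_time a b == m.+1) = ((a == i) && (b == j)) || ((a == j) && (b == i)).
Proof.
move=> mN ij e e' ab; have om := sweep_is_order (ltnW mN).
have h1 := inverted_sweep ab mN; rewrite e' swap_inverted -?e // in h1.
have h0 : inverted (W m) i j = false by rewrite e flip_inverted_pair // -e.
rewrite eqn_leq -h1 ltnNge -(inverted_sweep ab (ltnW mN)).
case: (boolP (_ && (b == j))) => [/andP[/eqP ea /eqP eb]|_] /=.
  by rewrite ea eb h0.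
case: (boolP (_ && (b == i))) => [/andP[/eqP ea /eqP eb]|_] /=.
  by rewrite invertedC // 1?eq_sym // ea eb h0.
by rewrite !orbF andbN.
Qed.

(** A flip swaps a single pair. *)
Lemma flip_time_neq a b c : a != b -> a != c -> b != c ->
  flip_time a b != flip_time a c.
Proof.
move=> ab ac bc; apply/eqP => e.
have /andP[t0 tN] := flip_time_bounds ab.
have [m em] : exists m, flip_time a b = m.+1 by exists (flip_time a b).-1; lia.
have mN : m < N by rewrite -em.
case: sweepW => _ /(_ m mN)[s1 [i [j [s2 [ij _ e1 e2]]]]] _.
have := flip_time_step mN ij e1 e2 ab; rewrite em eqxx => /esym hb.
have := flip_time_step mN ij e1 e2 ac; rewrite -e em eqxx => /esym hc.
have nij : i != j by rewrite -val_eqE /= neq_ltn ij.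
move: hb hc ab ac bc nij.
case/orP=> /andP[/eqP-> /eqP->]; case/orP=> /andP[/eqP ? /eqP ?]; subst;
  by rewrite ?eqxx.
Qed.

Lemma inverted_lt w i j : is_order w -> i < j -> inverted w i j = (index j w < index i w).
Proof.
move=> ow ij; rewrite /inverted ij /before.
have : i != j by rewrite -val_eqE /= neq_ltn ij.
by move=> /(index_neq ow); lia.
Qed.

(** For i < j < k, transitivity gives that ik is inverted when both
ij and jk are, and that it is not when neither is; so the flip time of ik lies between
the two others. *)
Lemma flip_time_between i j k : i < j -> j < k ->
  flip_time i j < flip_time i k < flip_time j k \/
  flip_time j k < flip_time i k < flip_time i j.
Proof.
move=> ij jk; have ik := ltn_trans ij jk.
have [nij njk nik] : [/\ i != j, j != k & i != k].
  by rewrite -!val_eqE /=; split; lia.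
have /andP[_ bij] := flip_time_bounds nij.
have /andP[_ bjk] := flip_time_bounds njk.
have /andP[_ bik] := flip_time_bounds nik.
have h m : m <= N -> (flip_time i j <= m -> flip_time j k <= m -> flip_time i k <= m)
   /\ (flip_time i k <= m -> flip_time i j <= m \/ flip_time j k <= m).
  move=> mN; have om := sweep_is_order mN.
  by rewrite -!inverted_sweep // !inverted_lt //; lia.
have := h _ bik; have [|h1 _] := h (maxn (flip_time i j) (flip_time j k)).
  by rewrite geq_max bij.
have nki : k != i by rewrite eq_sym.
have nkj : k != j by rewrite eq_sym.
have := flip_time_neq nij nik njk; have := flip_time_neq nki nkj nij.
by rewrite !(flip_timeC k); lia.
Qed.

(** In a triple any two pairs share a color, here a, so this compares all
pairs of pairs of the triple. *)
Definition obedient x := forall a b c, a != b -> a != c -> b != c ->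
  flip_time a b < flip_time a c -> inverted x a c -> inverted x a b.

(** If ij is flipped before jk, the orders excluded by obedience are the two
in which j is the greatest of the triple; otherwise those in which it is the least. *)
Lemma obedientP x : is_order x ->
  obedient x <-> forall i j k, i < j -> j < k ->
    if flip_time i j < flip_time j k then ~~ (before x i j && before x k j)
    else ~~ (before x j i && before x j k).
Proof.
move=> ox; split => [ob i j k ij jk | h a b c ab ac bc].
  have ik := ltn_trans ij jk.
  have [nij njk nik] : [/\ i != j, j != k & i != k].
    by rewrite -!val_eqE /=; split; lia.
  have nkj : k != j by rewrite eq_sym.
  have nki : k != i by rewrite eq_sym.
  have nji : j != i by rewrite eq_sym.
  have := index_neq ox nij; have := index_neq ox njk; have := index_neq ox nik.
  have bt := flip_time_between ij jk.
  case: ifP => lt.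
    have /andP[t1 t2] : flip_time i j < flip_time i k < flip_time j k.
      by case: bt => // /andP[t1 t2]; move: (ltn_trans t1 t2) lt; lia.
    have := ob _ _ _ nij nik njk t1.
    have := ob _ _ _ nki nkj nij; rewrite !(flip_timeC k) => /(_ t2).
    rewrite !(invertedC ox (_ : _ != k)) // !inverted_lt // /before; clear; lia.
  have /andP[t1 t2] : flip_time j k < flip_time i k < flip_time i j.
    by case: bt => // /andP[t1 t2]; move: (ltn_trans t1 t2) lt; lia.
  have := ob _ _ _ nkj nki nji; rewrite !(flip_timeC k) => /(_ t1).
  have := ob _ _ _ nik nij nkj t2.
  rewrite !(invertedC ox (_ : _ != k)) // !inverted_lt // /before; clear; lia.
have sorted_case i j k : i < j -> j < k ->
   [/\ (flip_time i j < flip_time i k -> inverted x i k -> inverted x i j)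
     /\ (flip_time i k < flip_time i j -> inverted x i j -> inverted x i k),
       (flip_time i j < flip_time j k -> inverted x j k -> inverted x i j)
     /\ (flip_time j k < flip_time i j -> inverted x i j -> inverted x j k)
     & (flip_time i k < flip_time j k -> inverted x j k -> inverted x i k)
     /\ (flip_time j k < flip_time i k -> inverted x i k -> inverted x j k)].
  move=> ij jk; have ik := ltn_trans ij jk.
  have [nij njk nik] : [/\ i != j, j != k & i != k].
    by rewrite -!val_eqE /=; split; lia.
  have := index_neq ox nij; have := index_neq ox njk; have := index_neq ox nik.
  move: (h _ _ _ ij jk); rewrite !inverted_lt // /before.
  case: ifP => lt; case: (flip_time_between ij jk) => /andP[t1 t2].
  - by clear -t1 t2; repeat split; lia.
  - by clear -t1 t2 lt; lia.
  - by clear -t1 t2 lt; lia.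
  - by clear -t1 t2; repeat split; lia.
have ba : b != a by rewrite eq_sym.
have ca : c != a by rewrite eq_sym.
have cb : c != b by rewrite eq_sym.
have tot (u v : 'I_n) : u != v -> u < v \/ v < u by rewrite -val_eqE /=; lia.
have [lab|lba] := tot _ _ ab; have [lac|lca] := tot _ _ ac;
  have [lbc|lcb] := tot _ _ bc.
- by have [[]] := sorted_case _ _ _ lab lbc.
- by have [[]] := sorted_case _ _ _ lac lcb.
- by lia.
- by have [_ [_]] := sorted_case _ _ _ lca lab;
    rewrite (flip_timeC c a) (invertedC ox ac).
- by have [_ []] := sorted_case _ _ _ lba lac;
    rewrite (flip_timeC b a) (invertedC ox ab).
- by lia.
- by have [_ _ []] := sorted_case _ _ _ lbc lca;
    rewrite (flip_timeC b a) (flip_timeC c a) (invertedC ox ab) (invertedC ox ac).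
- by have [_ _ [_]] := sorted_case _ _ _ lcb lba;
    rewrite (flip_timeC b a) (flip_timeC c a) (invertedC ox ab) (invertedC ox ac).
Qed.

(** The words constructed in the proof are the y with inverted pairs
those of x flipped by time m; they lead from alpha at time 0 to x at time N. *)
Lemma obedient_ind (P : seq 'I_n -> Prop) :
    P (enum 'I_n) ->
    (forall s1 s1' i j s2, i < j -> E s1 i j -> perm_eq s1 s1' ->
       P (s1' ++ i :: j :: s2) -> P (s1' ++ j :: i :: s2)) ->
  forall x, is_order x -> obedient x -> P x.
Proof.
move=> P0 Pflip x ox obx.
have [W0 Ws WN] := sweepW.
suff main m : m <= N -> exists y, [/\ is_order y, P y & forall a b, a != b ->
    inverted y a b = inverted x a b && (flip_time a b <= m)].
  have [y [oy Py iy]] := main N (leqnn N).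
  rewrite (_ : x = y) //; apply: before_inj => // a b.
  have [->|ab] := eqVneq a b; first by rewrite /before !ltnn.
  rewrite !beforeE iy //; have /andP[_ ->] := flip_time_bounds ab.
  by rewrite andbT.
elim: m => [|m IH] mN.
  exists (enum 'I_n); split=> // [|a b ab]; first exact: perm_refl.
  rewrite /inverted before_enum eqxx /=; have /andP[+ _] := flip_time_bounds ab.
  by rewrite lt0n leqn0 => /negPf ->; rewrite andbF.
have [y [oy Py iy]] := IH (ltnW mN).
have [s1 [i [j [s2 [ij Eij e e']]]]] := Ws m mN.
have om := sweep_is_order (ltnW mN).
have nij : i != j by rewrite -val_eqE /= neq_ltn ij.
have tij : flip_time i j = m.+1.
  by apply/eqP; rewrite (flip_time_step mN ij e e' nij) !eqxx.
have tstep a b : a != b -> (flip_time a b <= m.+1) = (flip_time a b <= m)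
    || ((a == i) && (b == j)) || ((a == j) && (b == i)).
  move=> ab; rewrite leq_eqVlt (flip_time_step mN ij e e' ab) ltnS.
  by rewrite orbC orbA.
have [xij|xij] := boolP (inverted x i j); last first.
  exists y; split => // a b ab; rewrite iy // tstep //.
  case: (boolP ((a == i) && _)) => [/andP[/eqP-> /eqP->]|_] /=.
    by rewrite (negPf xij).
  case: (boolP ((a == j) && _)) => [/andP[/eqP-> /eqP->]|_] /=.
    by rewrite (invertedC ox nij) (negPf xij).
  by rewrite !orbF.
(* Around i and j the words y and W m agree: a pair with one color in {i, j}
   that is flipped before time m.+1 is inverted in x by obedience. *)
have agree a b c : (a == i) && (b == j) || (a == j) && (b == i) ->
    c != i -> c != j -> before y a c = before (W m) a c.
  move=> ab ci cj.
  have [ac bc nab] : [/\ a != c, b != c & a != b].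
    by case/orP: ab => /andP[/eqP -> /eqP ->]; split; rewrite // eq_sym.
  have tab : flip_time a b = m.+1.
    by case/orP: ab => /andP[/eqP -> /eqP ->]; rewrite // flip_timeC.
  have xab : inverted x a b.
    by case/orP: ab => /andP[/eqP -> /eqP ->]; rewrite // (invertedC ox nij).
  rewrite !beforeE iy // (inverted_sweep ac (ltnW mN)).
  case: (leqP (flip_time a c) m) => [tac|_]; last by rewrite andbF.
  rewrite (obx a c b) //; first by rewrite eq_sym.
  by rewrite tab.
have iym a : (a \in s1) = before (W m) a i by rewrite e (@mem_prefix _ s1 (j :: s2) a i) -?e.
have before_j c : c != i -> c != j -> before (W m) c j = before (W m) c i.
  move=> ci cj.
  have e3 : W m = (s1 ++ [:: i]) ++ j :: s2 by rewrite e -catA.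
  rewrite -iym {1}e3 -(@mem_prefix _ (s1 ++ [:: i]) s2 c j) -?e3 //.
  by rewrite mem_cat inE (negPf ci) orbF.
have [t1 [t2 ey]] : exists t1 t2, y = t1 ++ i :: j :: t2.
  apply: cat_of_adjacent => //.
    by rewrite beforeE iy // tij ltnn andbF ij.
  move=> c ci cj.
  rewrite (agree i j) ?eqxx // (agree j i) ?eqxx ?orbT //.
  rewrite (@beforeN _ (W m) c i) // (@beforeN _ (W m) c j) //.
  by rewrite before_j.
have permt : perm_eq s1 t1.
  have us1 : uniq s1 by have := is_order_uniq om; rewrite e cat_uniq => /and3P[].
  have ut1 : uniq t1 by have := is_order_uniq oy; rewrite ey cat_uniq => /and3P[].
  apply: (uniq_perm us1 ut1) => c.
  rewrite iym (@mem_prefix _ t1 (j :: t2) c i) -?ey //.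
  have [->|ci] := eqVneq c i; first by rewrite /before !ltnn.
  have [->|cj] := eqVneq c j.
    rewrite (beforeN om nij) (beforeN oy nij) !beforeE iy //.
    by rewrite (inverted_sweep nij (ltnW mN)) tij ltnn andbF.
  rewrite (@beforeN _ (W m) i c) 1?eq_sym // (@beforeN _ y i c) 1?eq_sym //.
  by rewrite (agree i j) // !eqxx.
exists (t1 ++ j :: i :: t2); rewrite ey in oy Py iy.
split; [by rewrite swap_is_order | exact: Pflip Eij permt Py |].
move=> a b ab; rewrite swap_inverted // iy // tstep //.
case: (boolP ((a == i) && _)) => [/andP[/eqP-> /eqP->]|_] /=.
  by rewrite xij !orbT.
case: (boolP ((a == j) && _)) => [/andP[/eqP-> /eqP->]|_] /=.
  by rewrite (invertedC ox nij) xij !orbT.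
by rewrite !orbF.
Qed.

(** A violation at i < j < k is visible on one initial segment of
x: the letters before j, containing i and k, or the letters up to j, containing
neither.  No word of the sweep has such an initial segment, by the order of the flip
times of ij and jk. *)
Lemma obedient_of_prefixes x : is_order x ->
    (forall s1 s2, x = s1 ++ s2 -> exists m u1 u2,
       [/\ m <= N, W m = u1 ++ u2 & perm_eq u1 s1]) ->
  obedient x.
Proof.
move=> ox pre; apply/(obedientP ox) => i j k ij jk.
have ik := ltn_trans ij jk.
have [nij njk nik] : [/\ i != j, j != k & i != k].
  by rewrite -!val_eqE /=; split; lia.
have [p1 [p2 ex]] : exists p1 p2, x = p1 ++ j :: p2.
  by case/splitPr: (is_order_mem j ox) => p1 p2; exists p1, p2.
case: ifP => lt; apply/negP.
  rewrite ex -!mem_prefix -?ex // => /andP[ip kp].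
  have [m [u1 [u2 [mN e pu]]]] := pre _ _ ex.
  have om := sweep_is_order mN.
  have ju : j \notin u1.
    rewrite (perm_mem pu) (@mem_prefix _ p1 p2 j j) -?ex //.
    by rewrite /before ltnn.
  rewrite -!(perm_mem pu) in ip kp.
  have : inverted (W m) j k.
    by rewrite inverted_lt // e !index_cat (negPf ju) kp ltn_addr // index_mem.
  have : inverted (W m) i j = false.
    rewrite inverted_lt // e !index_cat (negPf ju) ip ltnNge.
    by rewrite (leq_trans (index_size i u1)) ?leq_addr.
  by rewrite !inverted_sweep //; clear -lt; lia.
case/andP=> ji jk'.
have ex' : x = (p1 ++ [:: j]) ++ p2 by rewrite ex -catA.
have [m [u1 [u2 [mN e pu]]]] := pre _ _ ex'.
have om := sweep_is_order mN.
have ju : j \in u1 by rewrite (perm_mem pu) mem_cat inE eqxx orbT.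
have notin c : c != j -> before x j c -> c \notin u1.
  move=> cj; rewrite (beforeN ox cj); apply: contra.
  rewrite (perm_mem pu) mem_cat inE (negPf cj) orbF.
  by rewrite (@mem_prefix _ p1 p2 c j) -?ex.
have iu := notin i nij ji.
have ku : k \notin u1 by apply: notin; rewrite // eq_sym.
have : inverted (W m) i j.
  by rewrite inverted_lt // e !index_cat ju (negPf iu) ltn_addr // index_mem.
have : inverted (W m) j k = false.
  rewrite inverted_lt // e !index_cat ju (negPf ku) ltnNge.
  by rewrite (leq_trans (index_size j u1)) ?leq_addr.
by rewrite !inverted_sweep //; clear -lt; lia.
Qed.

Definition chain w a b c := before w a b && before w b c.

Definition never_last q p r := forall x, is_order x -> obedient x ->
  ~~ (before x p q && before x r q).

Definition never_first q p r := forall x, is_order x -> obedient x ->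
  ~~ (before x q p && before x q r).

Lemma never_sorted i j k : i < j -> j < k -> never_last j i k \/ never_first j i k.
Proof.
move=> ij jk.
have [lt|lt] := boolP (flip_time i j < flip_time j k); [left | right];
  by move=> x ox /(obedientP ox)/(_ _ _ _ ij jk); rewrite ?lt ?(negPf lt).
Qed.

(** Whatever the relative order of i, j, k is, the middle one of them is
excluded from the last or from the first place. *)
Lemma never3 i j k : uniq [:: i; j; k] ->
  [\/ never_last i j k \/ never_first i j k,
      never_last j k i \/ never_first j k i
    | never_last k i j \/ never_first k i j].
Proof.
rewrite /= !inE negb_or andbT => /andP[/andP[ij ik] jk].
have tot (u v : 'I_n) : u != v -> u < v \/ v < u by rewrite -val_eqE /=; lia.
have sw q p r : never_last q p r \/ never_first q p r ->
    never_last q r p \/ never_first q r p.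
  by case=> h; [left|right] => x ox obx; rewrite andbC; exact: h.
have [lij|lji] := tot _ _ ij; have [lik|lki] := tot _ _ ik;
  have [ljk|lkj] := tot _ _ jk; try lia.
- by apply/Or32/sw/never_sorted.
- by apply/Or33/never_sorted.
- by apply/Or31/sw/never_sorted.
- by apply/Or31/never_sorted.
- by apply/Or33/sw/never_sorted.
- by apply/Or32/never_sorted.
Qed.

(** In a cyclic triple of orders each of the three letters comes
once first and once last. *)
Lemma obedient_acyclic i j k x y z : uniq [:: i; j; k] ->
  is_order x -> is_order y -> is_order z ->
  obedient x -> obedient y -> obedient z ->
  ~ [/\ chain x i j k, chain y j k i & chain z k i j].
Proof.
move=> u ox oy oz bx by_ bz [/andP[x1 x2] /andP[y1 y2] /andP[z1 z2]].
have x3 := before_trans x1 x2; have y3 := before_trans y1 y2.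
have z3 := before_trans z1 z2.
case: (never3 u) => -[] h.
- by have := h y oy by_; rewrite y2 y3.
- by have := h x ox bx; rewrite x1 x3.
- by have := h z oz bz; rewrite z2 z3.
- by have := h y oy by_; rewrite y1 y3.
- by have := h x ox bx; rewrite x2 x3.
- by have := h z oz bz; rewrite z1 z3.
Qed.

Lemma sweep_before m i j : i < j -> m <= N ->
  before (W m) j i = (flip_time i j <= m).
Proof.
move=> ij mN; have om := sweep_is_order mN.
by rewrite -inverted_sweep ?inverted_lt // -val_eqE /= neq_ltn ij.
Qed.

Lemma before_sweep m i j : i < j -> m <= N ->
  before (W m) i j = (m < flip_time i j).
Proof.
move=> ij mN; have om := sweep_is_order mN.
rewrite ltnNge -sweep_before // -beforeN //.
by rewrite -val_eqE /= neq_ltn ij orbT.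
Qed.

(** For each of the four excluded restrictions of x the two missing
orders of a cyclic triple are found among alpha, omega and the word of the sweep just
after the first or the second flip of the triple. *)
Lemma disobedient_cyclic x : is_order x -> ~ obedient x ->
  let D w := w = x \/ exists2 m, m <= N & w = W m in
  exists i j k, uniq [:: i; j; k] /\ exists w1 w2 w3, [/\ D w1, D w2 & D w3] /\
   ([/\ chain w1 i j k, chain w2 j k i & chain w3 k i j] \/
    [/\ chain w1 k j i, chain w2 j i k & chain w3 i k j]).
Proof.
move=> ox nob D.
have [i [j [k [ij jk bad]]]] : exists i j k, [/\ i < j, j < k &
    if flip_time i j < flip_time j k then before x i j && before x k j
    else before x j i && before x j k].
  apply: contrapT => h; apply/nob/(obedientP ox) => i j k ij jk.
  by case: ifP => lt; apply/negP => b; apply: h; exists i, j, k; rewrite lt.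
have ik := ltn_trans ij jk.
have [nij njk nik] : [/\ i != j, j != k & i != k].
  by rewrite -!val_eqE /=; split; lia.
have DW m : m <= N -> D (W m) by right; exists m.
exists i, j, k; split.
  by rewrite /= !inE negb_or nij nik njk.
have /andP[pij tij] := flip_time_bounds nij.
have /andP[pjk tjk] := flip_time_bounds njk.
have /andP[pik tik] := flip_time_bounds nik.
have first : chain (W 0) i j k.
  by rewrite /chain !before_sweep // pij pjk.
have last : chain (W N) k j i.
  by rewrite /chain !sweep_before // tij tjk.
have bt := flip_time_between ij jk.
have [xki|xki] := boolP (before x k i).
  (* x restricts to kij, or to jki. *)
  exists (W 0); case: ifP bad => lt /andP[b1 b2].
    exists (W (flip_time i k)), x; split; first by split; [exact: DW..|left].
    left; split => //; last by rewrite /chain xki.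
    rewrite /chain before_sweep // sweep_before // leqnn andbT.
    by case: bt; clear -lt; lia.
  exists x, (W (flip_time i k)); split; first by split; [exact: DW|left|exact: DW].
  left; split => //; first by rewrite /chain b2.
  rewrite /chain sweep_before // before_sweep // leqnn.
  by case: bt; clear -lt; lia.
(* x restricts to ikj, or to jik. *)
have bik : before x i k by rewrite (@beforeN _ x k i) // eq_sym.
exists (W N); case: ifP bad => lt /andP[b1 b2].
  exists (W (flip_time i j)), x; split; first by split; [exact: DW..|left].
  right; split => //; last by rewrite /chain bik.
  rewrite /chain sweep_before // before_sweep // leqnn.
  by case: bt; clear -lt; lia.
exists x, (W (flip_time j k)); split; first by split; [exact: DW|left|exact: DW].
right; split => //; first by rewrite /chain b1.
rewrite /chain before_sweep // sweep_before // leqnn andbT.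
by case: bt; clear -lt; lia.
Qed.

End Sweeps.

Local Open Scope classical_set_scope.
Local Open Scope ring_scope.

(** * The zonogon *)

Section Plane.
Variables (R : realType) (n : nat) (xi : 'I_n -> 'rV[R]_2).
Hypothesis hxi : zonogon_vectors xi.
Implicit Types (p q v u : 'rV[R]_2) (i j k : 'I_n) (s : seq 'I_n) (a b c : R).

Lemma plane_eq p q : p 0 0 = q 0 0 -> p 0 1 = q 0 1 -> p = q.
Proof.
move=> e0 e1; apply/rowP => j.
by case: j => -[|[|//]] hj; [have -> : Ordinal hj = 0 by apply/val_inj
  | have -> : Ordinal hj = 1 by apply/val_inj].
Qed.

Definition det p q := p 0 0 * q 0 1 - p 0 1 * q 0 0.

Definition east : 'rV[R]_2 := \row_j (j == 0)%:R.

Lemma xi_gt0 i : 0 < xi i 0 1. Proof. by case: hxi. Qed.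

Lemma det_lt0 i j : (i < j)%N -> det (xi i) (xi j) < 0.
Proof. by case: hxi => _ _; exact. Qed.

Lemma tile_coord_ex i j v : (i < j)%N ->
  exists a b, v = a *: xi i + b *: xi j.
Proof.
move=> /det_lt0 d; have {d} : det (xi i) (xi j) != 0 by rewrite lt_eqF.
rewrite /det => d.
exists (det v (xi j) / det (xi i) (xi j)), (det (xi i) v / det (xi i) (xi j)).
by apply: plane_eq; rewrite !mxE /det; field.
Qed.

Lemma tile_coord_inj i j a b a' b' : (i < j)%N ->
  a *: xi i + b *: xi j = a' *: xi i + b' *: xi j -> a = a' /\ b = b'.
Proof.
move=> /det_lt0 d e.
have e0 := congr1 (fun p : 'rV[R]_2 => p 0 0) e.
have e1 := congr1 (fun p : 'rV[R]_2 => p 0 1) e.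
rewrite !mxE in e0 e1.
have nz : det (xi i) (xi j) != 0 by rewrite lt_eqF.
split; apply: (mulIf nz); rewrite /det.
  have := congr1 (fun z => z * xi j 0 1) e0; have := congr1 (fun z => z * xi j 0 0) e1.
  by rewrite /=; lra.
have := congr1 (fun z => z * xi i 0 1) e0; have := congr1 (fun z => z * xi i 0 0) e1.
by rewrite /=; lra.
Qed.

(** The horizontal vector to the right leaves a tile through its right
edges: its coordinate on the left direction i is negative, the one on j positive. *)
Lemma east_coord i j : (i < j)%N ->
  exists l m, [/\ 0 < l, 0 < m & east = m *: xi j - l *: xi i].
Proof.
move=> /det_lt0; have := xi_gt0 i; have := xi_gt0 j.
rewrite /det => yj yi d.
set D := xi j 0 0 * xi i 0 1 - xi j 0 1 * xi i 0 0.
have D0 : 0 < D by rewrite /D; lra.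
exists (xi j 0 1 / D), (xi i 0 1 / D); split; try exact: divr_gt0.
have Dn : D != 0 by rewrite gt_eqF.
by apply: plane_eq; rewrite !mxE /=; rewrite /D in Dn *; field.
Qed.

Definition pt s : 'rV[R]_2 := \sum_(i <- s) xi i.

Lemma pt_cat s s' : pt (s ++ s') = pt s + pt s'.
Proof. by rewrite /pt big_cat. Qed.

Lemma pt_cons k s : pt (k :: s) = xi k + pt s.
Proof. by rewrite /pt big_cons. Qed.

Lemma pt_nil : pt [::] = 0.
Proof. by rewrite /pt big_nil. Qed.

Lemma pt_perm s s' : perm_eq s s' -> pt s = pt s'.
Proof. by move=> e; rewrite /pt (perm_big _ e). Qed.

Lemma pt_ge0 s : 0 <= (pt s) 0 1.
Proof. by rewrite /pt summxE sumr_ge0 // => i _; rewrite ltW // xi_gt0. Qed.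

Lemma zonogon_sum s (c : 'I_n -> R) : uniq s -> (forall i, 0 <= c i <= 1) ->
  zonogon xi (\sum_(i <- s) c i *: xi i).
Proof.
move=> us hc; exists (fun i => if i \in s then c i else 0).
  by move=> i; case: ifP => // _; rewrite lexx ler01.
rewrite big_uniq //= [LHS]big_mkcond; apply: eq_bigr => i _.
by case: ifP => // _; rewrite scale0r.
Qed.

Lemma zonogon_pt2 s i j a b : uniq (s ++ [:: i; j]) ->
  0 <= a <= 1 -> 0 <= b <= 1 -> zonogon xi (pt s + a *: xi i + b *: xi j).
Proof.
move=> us ha hb.
have h01 : 0 <= (1 : R) <= 1 by rewrite ler01 lexx.
have hc l : 0 <= (if l == i then a else if l == j then b else 1 : R) <= 1.
  by case: ifP => // _; case: ifP.
have := zonogon_sum us hc; rewrite big_cat /= !big_cons big_nil eqxx.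
move: us; rewrite cat_uniq /= orbF negb_or inE => /and3P[_ /andP[is_ js] /andP[ij _]].
rewrite eq_sym (negPf ij) eqxx addr0 addrA.
rewrite (_ : \sum_(l <- s) _ = pt s) //; apply: eq_big_seq => l ls.
case: eqP ls => [->|_]; first by rewrite (negPf is_).
by case: eqP => [->|_]; rewrite ?(negPf js) // scale1r.
Qed.

Lemma zonogon_pt1 s i a : uniq (rcons s i) -> 0 <= a <= 1 ->
  zonogon xi (pt s + a *: xi i).
Proof.
move=> us ha.
have h01 : 0 <= (1 : R) <= 1 by rewrite ler01 lexx.
have hc l : 0 <= (if l == i then a else 1 : R) <= 1 by case: ifP.
have := zonogon_sum us hc; rewrite big_rcons /= eqxx.
move: us; rewrite rcons_uniq => /andP[is_ _].
rewrite (_ : \sum_(l <- s) _ = pt s) //; apply: eq_big_seq => l ls.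
by case: eqP ls => [->|_]; rewrite ?(negPf is_) // scale1r.
Qed.

Lemma zonogon_convex p q c : zonogon xi p -> zonogon xi q -> 0 <= c <= 1 ->
  zonogon xi ((1 - c) *: p + c *: q).
Proof.
move=> [f hf ->] [g hg ->] /andP[c0 c1].
exists (fun i => (1 - c) * f i + c * g i).
  by move=> i; have /andP[? ?] := hf i; have /andP[? ?] := hg i; nra.
under [RHS]eq_bigr do rewrite scalerDl -!scalerA.
by rewrite big_split /= !scaler_sumr.
Qed.

(** For a point p of the zonogon: p is off the right boundary. *)
Definition movable p := exists2 c, 0 < c & zonogon xi (p + c *: east).

(** By convexity: if one end of a segment is off the right boundary, so is
every point of it other than the opposite end. *)
Lemma movable_segment p q c : movable p -> zonogon xi q -> 0 <= c < 1 ->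
  movable ((1 - c) *: p + c *: q).
Proof.
move=> [d d0 Zp] Zq /andP[c0 c1]; exists ((1 - c) * d).
  by rewrite mulr_gt0 // subr_gt0.
rewrite addrAC -scalerA -scalerDr; apply: zonogon_convex => //.
by rewrite c0 ltW.
Qed.

Lemma zonogon_height0 p : zonogon xi p -> p 0 1 = 0 -> p = 0.
Proof.
move=> [a ha ->]; rewrite summxE => h.
have ge0 l : true -> 0 <= (a l *: xi l) 0 1.
  move=> _; have /andP[al _] := ha l.
  by rewrite mxE mulr_ge0 // ltW // xi_gt0.
rewrite big1 // => i _; have := psumr_eq0P ge0 h (i := i) isT.
move/eqP; rewrite mxE mulf_eq0 (gt_eqF (xi_gt0 i)) orbF => /eqP ->.
by rewrite scale0r.
Qed.

Lemma zonogon_sym p : zonogon xi p -> zonogon xi (zonogon_top xi - p).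
Proof.
move=> [a ha ->]; exists (fun i => 1 - a i).
  by move=> i; have /andP[? ?] := ha i; lra.
by rewrite -sumrB; apply: eq_bigr => i _; rewrite scalerBl scale1r.
Qed.

Lemma unmovable0 : ~ movable 0.
Proof.
move=> [c c0 Z]; have := zonogon_height0 Z; rewrite !mxE /= mulr0 addr0.
by move=> /(_ erefl)/rowP/(_ 0); rewrite !mxE /=; lra.
Qed.

Lemma unmovable_top : ~ movable (zonogon_top xi).
Proof.
move=> [c c0 /zonogon_sym Z]; have := zonogon_height0 Z.
rewrite opprD addrA subrr add0r !mxE /= mulr0 oppr0.
move=> /(_ erefl)/rowP/(_ 0); rewrite !mxE /=; lra.
Qed.

End Plane.

(** Closedness of a half-line, in the form needed for points approached
along a ray. *)
Lemma ge0_of_small (R : realType) (x y : R) :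
  (forall d, 0 < d -> exists c, [/\ 0 < c, c <= d & 0 <= x + c * y]) -> 0 <= x.
Proof.
move=> h; rewrite leNgt; apply/negP => x0.
have y1 : 0 < `|y| + 1 by rewrite ltr_wpDl.
have [|c [c0 cd]] := h (- x / 2 / (`|y| + 1)).
  by rewrite divr_gt0 // divr_gt0 // oppr_gt0.
rewrite ler_pdivlMr // in cd.
have := ler_norm y; nra.
Qed.

(** * Tiles near a point *)

Section Tiling.
Variables (R : realType) (n : nat) (xi : 'I_n -> 'rV[R]_2).
Hypothesis hxi : zonogon_vectors xi.
Variable T : set (tile R n).
Hypothesis hT : rhombus_tiling xi T.
Hypothesis n1 : (1 < n)%N.
Implicit Types (p q v u : 'rV[R]_2) (i j k : 'I_n) (s : seq 'I_n) (a b c d : R).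
Implicit Types t : tile R n.

Lemma tile_lt t : T t -> (tile_lo t < tile_hi t)%N.
Proof. by case: hT => _ h _ _; exact: h. Qed.

Lemma tile_zonogon t p : T t -> tile_region xi t p -> zonogon xi p.
Proof. by case: hT => _ _ /(_ n1) <- _ Tt tp; exists t. Qed.

(** Pigeonhole: finitely many tiles cover the points q + c u with c
small, so one of them contains such points for arbitrarily small c. *)
Lemma tile_along_ray q u : (exists2 d, 0 < d & forall c, 0 < c <= d ->
    zonogon xi (q + c *: u)) ->
  exists2 t, T t & forall d, 0 < d -> exists c, [/\ 0 < c, c <= d
                                            & tile_region xi t (q + c *: u)].
Proof.
case=> d d0 Zq; apply: contrapT => no.
case: hT => -[m Tm] _ /(_ n1) Tcover _.
have /card_set_bijP[f [fT finj _]] := Tm.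
have miss t : T t -> exists2 e, 0 < e & forall c, 0 < c -> c <= e ->
    ~ tile_region xi t (q + c *: u).
  move=> Tt; apply: contrapT => h; apply: no; exists t => // e e0.
  apply: contrapT => h'; apply: h; exists e => // c c0 ce tc.
  by apply: h'; exists c.
have missk (r : nat) : exists2 e, 0 < e & forall t, T t -> (f t < r)%N ->
    forall c, 0 < c -> c <= e -> ~ tile_region xi t (q + c *: u).
  elim: r => [|r [e e0 IH]]; first by exists 1.
  have [[t0 Tt0 ft0]|nt] := pselect (exists2 t, T t & f t = r); last first.
    exists e => // t Tt; rewrite ltnS leq_eqVlt => /orP[/eqP ft|]; last exact: IH.
    by case: nt; exists t.
  have [e' e'0 h'] := miss t0 Tt0; exists (Num.min e e').
    by rewrite lt_min e0.
  move=> t Tt ft c c0; rewrite le_min => /andP[ce ce'].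
  move: ft; rewrite ltnS leq_eqVlt => /orP[/eqP ft|ft]; last exact: (IH t).
  by rewrite (finj t t0) ?inE // ?ft ?ft0 //; exact: h'.
have [e e0 h] := missk m.
have c0 : 0 < Num.min d e by rewrite lt_min d0.
have := Zq (Num.min d e); rewrite c0 ge_min lexx /= -Tcover => /(_ isT)[t Tt].
by apply: h => //; [exact: fT | rewrite ge_min lexx orbT].
Qed.

Lemma tile_regionP t p : tile_region xi t p <-> exists a b,
  [/\ 0 <= a <= 1, 0 <= b <= 1
    & p = tile_base t + (a *: xi (tile_lo t) + b *: xi (tile_hi t))].
Proof. by split=> -[a [b [? ? ->]]]; exists a, b; rewrite addrA. Qed.

(** The coordinates in a tile are affine along a ray, so the closed
conditions that define the tile pass to the limit. *)
Lemma tile_region_limit t q u : T t ->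
    (forall d, 0 < d -> exists c, [/\ 0 < c, c <= d
                                   & tile_region xi t (q + c *: u)]) ->
  tile_region xi t q.
Proof.
move=> Tt h; have ij := tile_lt Tt.
have [a [b eq_]] := tile_coord_ex hxi (q - tile_base t) ij.
have {}eq_ : q = tile_base t + (a *: xi (tile_lo t) + b *: xi (tile_hi t)).
  by rewrite -eq_ addrC subrK.
have [a' [b' eu]] := tile_coord_ex hxi u ij.
have {}h e : 0 < e -> exists c, [/\ 0 < c, c <= e,
    0 <= a + c * a' <= 1 & 0 <= b + c * b' <= 1].
  move=> /h[c [c0 ce /tile_regionP[x [y [hx hy]]]]].
  rewrite eq_ eu -addrA => /addrI e1; exists c.
  have [-> ->] // : a + c * a' = x /\ b + c * b' = y.
  apply: (tile_coord_inj hxi ij); rewrite -e1 scalerDr !scalerA !scalerDl.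
  by rewrite addrACA.
apply/tile_regionP; exists a, b; split => //; apply/andP; split.
- apply: (@ge0_of_small _ _ a') => e /h[c [c0 ce /andP[? _] _]]; exists c.
  by split.
- rewrite -subr_ge0; apply: (@ge0_of_small _ _ (- a')) => e /h[c [c0 ce /andP[_ ?] _]].
  by exists c; split => //; lra.
- apply: (@ge0_of_small _ _ b') => e /h[c [c0 ce _ /andP[? _]]]; exists c.
  by split.
- rewrite -subr_ge0; apply: (@ge0_of_small _ _ (- b')) => e /h[c [c0 ce _ /andP[_ ?]]].
  by exists c; split => //; lra.
Qed.

Lemma tile_vertex_coord t v : tile_vertices xi t v -> exists a b,
  [/\ a = 0 \/ a = 1, b = 0 \/ b = 1
    & v = tile_base t + (a *: xi (tile_lo t) + b *: xi (tile_hi t))].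
Proof.
case: t => i j p /= [[[|]|]|] ->.
- by exists 0, 0; rewrite !scale0r !addr0; split; auto.
- by exists 1, 0; rewrite scale1r scale0r addr0; split; auto.
- by exists 0, 1; rewrite scale1r scale0r add0r; split; auto.
- by exists 1, 1; rewrite !scale1r addrA; split; auto.
Qed.

Lemma tile_edge_coord t (e : edge R n) : tile_edges xi t e ->
  let point a b := tile_base t + (a *: xi (tile_lo t) + b *: xi (tile_hi t)) in
  [\/ e = (tile_base t, tile_lo t) /\ forall a, e.1 + a *: xi e.2 = point a 0,
      e = (tile_base t, tile_hi t) /\ forall a, e.1 + a *: xi e.2 = point 0 a,
      e = (tile_base t + xi (tile_hi t), tile_lo t)
        /\ forall a, e.1 + a *: xi e.2 = point a 1
    | e = (tile_base t + xi (tile_lo t), tile_hi t)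
        /\ forall a, e.1 + a *: xi e.2 = point 1 a].
Proof.
case: t => i j p /= [[[|]|]|] ->.
- by apply: Or41; split=> // a /=; rewrite scale0r addr0.
- by apply: Or42; split=> // a /=; rewrite scale0r add0r.
- by apply: Or43; split=> // a /=; rewrite scale1r addrAC addrA.
- by apply: Or44; split=> // a /=; rewrite scale1r addrA.
Qed.

(** Vertices and edges of t have some coordinate 0 or 1, so an
interior point of t cannot lie in the intersection with a different tile. *)
Lemma tile_eq_of_interior t t' a b : T t -> T t' -> 0 < a < 1 -> 0 < b < 1 ->
  tile_region xi t' (tile_base t + (a *: xi (tile_lo t) + b *: xi (tile_hi t))) ->
  t = t'.
Proof.
move=> Tt Tt' /andP[a0 a1] /andP[b0 b1] h.
set q := _ + _ in h; apply: contrapT => ntt'.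
have ij := tile_lt Tt.
have tq : tile_region xi t q.
  by apply/tile_regionP; exists a, b; rewrite !ltW.
have tt'q : (tile_region xi t `&` tile_region xi t') q by [].
case: hT => _ _ _ /(_ t t' Tt Tt' ntt')[e|[v [tv _] e]|[ed [ted _] e]].
- by move: tt'q; rewrite e.
- move: tt'q; rewrite e /= => qv; have [x [y [hx _]]] := tile_vertex_coord tv.
  rewrite -qv => /addrI/(tile_coord_inj hxi ij)[e1 _].
  by case: hx => hx; lra.
- move: tt'q; rewrite e => -[c _].
  by case: (tile_edge_coord ted) => -[_ ->] /addrI/(tile_coord_inj hxi ij)[e1 e2];
    lra.
Qed.

(** Moving to the right from the left vertex, which has coordinates (1, 0),
decreases the first coordinate and increases the second one ([east_coord]). *)
Lemma left_vertex_interior t : T t -> exists2 d, 0 < d & forall c, 0 < c <= d ->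
  exists a b, [/\ 0 < a < 1, 0 < b < 1 & tile_base t + xi (tile_lo t) + c *: east R
     = tile_base t + (a *: xi (tile_lo t) + b *: xi (tile_hi t))].
Proof.
move=> /tile_lt ij; have [l [m [l0 m0 ->]]] := east_coord hxi ij.
have lm : 0 < l + m + 1 by lra.
exists (l + m + 1)^-1; first by rewrite invr_gt0.
move=> c /andP[c0]; rewrite -[_^-1]mul1r ler_pdivlMr // => cd.
exists (1 - c * l), (c * m); split; [nra | nra |].
rewrite -addrA; congr (_ + _); apply: plane_eq; rewrite !mxE; ring.
Qed.

(** The tile to the right of the edge (p, k) has this edge either as its lower
left or as its upper left edge. *)
Definition lower_left p k := exists j, T (Tile k j p).
Definition upper_left p k := exists i, T (Tile i k (p - xi i)).

Lemma left_vertex_movable t : T t -> movable xi (tile_base t + xi (tile_lo t)).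
Proof.
move=> Tt; have [d d0 h] := left_vertex_interior Tt; exists d => //.
have [|a [b [/andP[? ?] /andP[? ?] ->]]] := h d; first by rewrite d0 lexx.
by apply: (tile_zonogon Tt); apply/tile_regionP; exists a, b; rewrite !ltW.
Qed.

Lemma lower_left_movable p k : lower_left p k -> movable xi (p + xi k).
Proof. by move=> [j /left_vertex_movable]. Qed.

Lemma upper_left_movable p k : upper_left p k -> movable xi p.
Proof. by move=> [i /left_vertex_movable]; rewrite /= subrK. Qed.

(** Two tiles with the same left vertex overlap just to the right of
it. *)
Lemma left_vertex_inj t t' : T t -> T t' ->
  tile_base t + xi (tile_lo t) = tile_base t' + xi (tile_lo t') -> t = t'.
Proof.
move=> Tt Tt' e; have [d d0 h] := left_vertex_interior Tt.
have [d' d'0 h'] := left_vertex_interior Tt'.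
have m0 : 0 < Num.min d d' by rewrite lt_min d0.
have [|a [b [ha hb eq1]]] := h (Num.min d d'); first by rewrite m0 ge_min lexx.
have [|a' [b' [/andP[? ?] /andP[? ?] eq2]]] := h' (Num.min d d').
  by rewrite m0 ge_min lexx orbT.
apply: (tile_eq_of_interior Tt Tt' ha hb); rewrite -eq1 e eq2.
by apply/tile_regionP; exists a', b'; rewrite !ltW.
Qed.

(** At the vertex between the two edges, both tiles have their left
vertex, so they are the same tile. *)
Lemma lower_upper_tile p k k' : lower_left p k -> upper_left (p + xi k) k' ->
  T (Tile k k' p) /\ (k < k')%N.
Proof.
move=> [j Tt] [i Tt']; have := left_vertex_inj Tt Tt'.
rewrite /= subrK => /(_ erefl)[ei ej _]; rewrite -ej; split => //.
exact: (tile_lt Tt).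
Qed.
End Tiling.

(** * Snakes can be pushed to the right *)

Section Snakes.
Variables (R : realType) (n : nat) (xi : 'I_n -> 'rV[R]_2).
Hypothesis hxi : zonogon_vectors xi.
Variable T : set (tile R n).
Hypothesis hT : rhombus_tiling xi T.
Hypothesis n1 : (1 < n)%N.
Implicit Types (p q v u : 'rV[R]_2) (i j k : 'I_n) (s w : seq 'I_n) (a b c d : R).
Implicit Types t : tile R n.

Lemma tile_edge_region t (e : edge R n) a : tile_edges xi t e -> 0 <= a <= 1 ->
  tile_region xi t (e.1 + a *: xi e.2).
Proof.
move=> te ha; apply/tile_regionP.
have h0 : 0 <= (0 : R) <= 1 by rewrite lexx ler01.
have h1 : 0 <= (1 : R) <= 1 by rewrite lexx ler01.
by case: (tile_edge_coord te) => -[_ ->];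
  [exists a, 0 | exists 0, a | exists a, 1 | exists 1, a].
Qed.

Lemma tile_edge_uniq t (e e' : edge R n) a b : T t ->
  tile_edges xi t e -> tile_edges xi t e' -> 0 < a < 1 ->
  e.1 + a *: xi e.2 = e'.1 + b *: xi e'.2 -> e = e'.
Proof.
move=> Tt te te' /andP[a0 a1]; have ij := tile_lt hT Tt.
by case: (tile_edge_coord te) => -[-> ->];
   case: (tile_edge_coord te') => -[-> ->];
   move/addrI/(tile_coord_inj hxi ij) => [e1 e2] //; exfalso; lra.
Qed.

Lemma graph_edgeP p k :
  graph_edges xi T (p, k) <-> exists2 t, T t & tile_edges xi t (p, k).
Proof. by split=> [[//|[nE _]]|]; [have := n1; rewrite {1}nE | left]. Qed.

Lemma movable_near p : movable xi p -> zonogon xi p ->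
  exists2 d, 0 < d & forall c, 0 < c <= d -> zonogon xi (p + c *: east R).
Proof.
move=> [d d0 Zd] Zp; exists d => // c /andP[c0 cd].
have := zonogon_convex Zp Zd (_ : 0 <= c / d <= 1).
rewrite scalerDr scalerA divfK ?gt_eqF // addrA -scalerDl subrK scale1r; apply.
by rewrite ler_pdivrMr // mul1r cd divr_ge0 // ltW.
Qed.

(** Move the given point inside the edge, where it is still movable; some
tile t contains it together with points to its right.  As t meets the tile of the edge
in a relative interior point of the edge, it shares this edge, and it lies to the right
of it. *)
Lemma right_tile p k a : graph_edges xi T (p, k) -> 0 <= a <= 1 ->
  movable xi (p + a *: xi k) -> lower_left T p k \/ upper_left xi T p k.
Proof.
move=> /graph_edgeP[t' Tt' et'] /andP[a0 a1] mova.
(* a' is strictly between 0 and 1 even if a is not. *)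
pose a' := (a + 2^-1) / 2.
have [a'0 a'1] : 0 < a' /\ a' < 1 by rewrite /a'; lra.
pose q := p + a' *: xi k.
have Zedge x : 0 <= x <= 1 -> zonogon xi (p + x *: xi k).
  by move=> hx; apply: (tile_zonogon hT n1 Tt'); exact: (tile_edge_region et').
have movq : movable xi q.
  have -> : q = (1 - 2^-1) *: (p + a *: xi k) + 2^-1 *: (p + 2^-1 *: xi k).
    by apply: plane_eq; rewrite /q /a' !mxE; field.
  by apply: movable_segment => //; [apply: Zedge; lra | lra].
have Zq : zonogon xi q by apply: Zedge; rewrite !ltW.
have [t Tt acc] := tile_along_ray hT n1 (movable_near movq Zq).
have tq := tile_region_limit hxi hT Tt acc.
have et : tile_edges xi t (p, k).
  have [-> //|ntt'] := pselect (t = t').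
  have t'q : tile_region xi t' q by apply: (tile_edge_region et'); rewrite !ltW.
  have tt'q : (tile_region xi t `&` tile_region xi t') q by [].
  have ij := tile_lt hT Tt'.
  case: hT => _ _ _ /(_ t t' Tt Tt' ntt')[e|[v [_ tv] e]|[ed [ted ted'] e]].
  - by move: tt'q; rewrite e.
  - move: tt'q; rewrite e /= => qv; exfalso.
    have [x [y [hx hy ev]]] := tile_vertex_coord tv.
    move: qv; rewrite ev; case: (tile_edge_coord et') => -[_ /= /(_ a') eq_];
      rewrite /q eq_ => /addrI/(tile_coord_inj hxi ij)[e1 e2]; lra.
  - move: tt'q; rewrite e => -[c hc qe].
    rewrite (_ : (p, k) = ed) //; apply: (tile_edge_uniq Tt' et' ted' _ qe).
    by rewrite a'0 a'1.
have [c [c0 _ /tile_regionP[x [y [/andP[hx hx'] /andP[hy hy']]]]]] := acc 1 ltr01.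
have ij := tile_lt hT Tt.
have [l [m [l0 m0 ee]]] := east_coord hxi ij.
have shift x' y' : tile_base t + (x' *: xi (tile_lo t) + y' *: xi (tile_hi t))
     + c *: east R
   = tile_base t + ((x' - c * l) *: xi (tile_lo t) + (y' + c * m) *: xi (tile_hi t)).
  by rewrite ee; apply: plane_eq; rewrite !mxE; ring.
have cl : 0 < c * l by exact: mulr_gt0.
have cm : 0 < c * m by exact: mulr_gt0.
case: (tile_edge_coord et) => -[/= [ep ek] /(_ a') eq_]; rewrite /q eq_ shift;
  move/addrI/(tile_coord_inj hxi ij) => [e1 e2].
- by left; exists (tile_hi t); rewrite ep ek; case: (t) Tt.
- by exfalso; lra.
- by exfalso; lra.
- by right; exists (tile_lo t); rewrite ep ek addrK; case: (t) Tt.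
Qed.

Fixpoint climbs p w : Prop :=
  if w is k :: w' then graph_edges xi T (p, k) /\ climbs (p + xi k) w' else True.

Lemma climbs_cat p s w : climbs p (s ++ w) <-> climbs p s /\ climbs (p + pt xi s) w.
Proof.
elim: s p => [|k s IH] p /=; first by rewrite pt_nil addr0; split=> [|[]].
by rewrite IH pt_cons addrA; split=> [[? []]|[[]]].
Qed.

Lemma climbs_edge p s k w : climbs p (s ++ k :: w) ->
  graph_edges xi T (p + pt xi s, k).
Proof. by move=> /climbs_cat[_ []]. Qed.

Lemma climbs_of_edges p w :
  (forall s k s', w = s ++ k :: s' -> graph_edges xi T (p + pt xi s, k)) ->
  climbs p w.
Proof.
elim: w p => //= k w IH p h; split.
  by have := h [::] k w erefl; rewrite pt_nil addr0.
by apply: IH => s l s' e; have := h (k :: s) l s'; rewrite pt_cons addrA e; apply.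
Qed.

Lemma climbs_swap p s i j w : T (Tile i j (p + pt xi s)) ->
  climbs p (s ++ i :: j :: w) -> climbs p (s ++ j :: i :: w).
Proof.
move=> Tt /climbs_cat[cs [_ [_ cw]]]; apply/climbs_cat; split => //=.
have ed e : tile_edges xi (Tile i j (p + pt xi s)) e -> graph_edges xi T e.
  by move=> te; left; exists (Tile i j (p + pt xi s)).
split; first by apply: ed; left; left; right.
split; first by apply: ed; left; right.
by rewrite addrAC.
Qed.

(** Follow the path upwards from an edge that has a tile on its
right in lower left position.  Its top vertex is movable, so the next edge has a tile on
its right too.  If that one is in upper left position, both tiles agree; otherwise go on.
The process stops since the end of the path is not movable. *)
Lemma tile_after_lower_left p k w : lower_left T p k -> climbs (p + xi k) w ->
    ~ movable xi (p + xi k + pt xi w) ->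
  exists s i j s', [/\ k :: w = s ++ i :: j :: s', (i < j)%N
                     & T (Tile i j (p + pt xi s))].
Proof.
elim: w p k => [|k' w IH] p k low /=.
  by rewrite pt_nil addr0 => _ []; exact: lower_left_movable low.
move=> [Ge cw] nmov.
have mov := lower_left_movable hxi hT n1 low.
have [||low'|up'] := right_tile (a := 0) Ge; rewrite ?scale0r ?addr0 ?lexx ?ler01 //.
  have [|s [i [j [s' [e ij Tt]]]]] := IH _ _ low' cw.
    by rewrite -addrA -pt_cons.
  by exists (k :: s), i, j, s'; rewrite e pt_cons addrA.
exists [::], k, k', w; rewrite pt_nil addr0.
by have [] := lower_upper_tile hxi hT low up'.
Qed.

(** The first edge of the path with a tile on its right starts at a
vertex that is not movable, so the tile is in lower left position. *)
Lemma tile_right_of_path p w s k s' : climbs p w -> ~ movable xi p ->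
    ~ movable xi (p + pt xi w) -> w = s ++ k :: s' ->
    lower_left T (p + pt xi s) k \/ upper_left xi T (p + pt xi s) k ->
  exists s i j s', [/\ w = s ++ i :: j :: s', (i < j)%N
                     & T (Tile i j (p + pt xi s))].
Proof.
elim: s p w => [|l s IH] p w.
  move=> cw np nend ew; rewrite pt_nil addr0; rewrite ew in cw nend *.
  case=> [low|/(upper_left_movable hxi hT n1)//].
  by case: cw => _ cw; apply: tile_after_lower_left => //; rewrite -addrA -pt_cons.
move=> cw np nend ew hside; rewrite ew /= in cw.
case: cw => Ge cw.
have [mov|nmov] := pselect (movable xi (p + xi l)).
  have [||low|up] := right_tile (a := 1) Ge; rewrite ?scale1r ?lexx ?ler01 //.
    rewrite ew; apply: tile_after_lower_left => //.
    by move: nend; rewrite ew cat_cons pt_cons addrA.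
  by case: np; exact: upper_left_movable up.
have [||i0 [i [j [s2 [e ij Tt]]]]] := IH _ _ cw nmov _ erefl.
- by move: nend; rewrite ew cat_cons pt_cons addrA.
- by move: hside; rewrite pt_cons addrA.
by exists (l :: i0), i, j, s2; rewrite ew cat_cons e pt_cons addrA.
Qed.

Definition tile_at s i j := T (Tile i j (pt xi s)).

Lemma pt_order w : is_order w -> pt xi w = zonogon_top xi.
Proof. by move=> ow; rewrite /pt /zonogon_top (perm_big _ ow) big_enum. Qed.

(** If a snake has a point off the right boundary, it can be pushed to the
right. *)
Lemma movable_flip w s k s' a : is_order w -> climbs 0 w -> w = s ++ k :: s' ->
  0 <= a <= 1 -> movable xi (pt xi s + a *: xi k) ->
  exists w', flip tile_at w w'.
Proof.
move=> ow cw ew ha mova.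
have Ge : graph_edges xi T (pt xi s, k).
  by have := @climbs_edge 0 s k s'; rewrite add0r -ew; apply.
have := tile_right_of_path (p := 0) cw (@unmovable0 _ _ _ hxi) _ ew.
rewrite !add0r => /(_ _ (right_tile Ge ha mova)).
case=> [|i0 [i [j [s2 [e ij Tt]]]]].
  by rewrite pt_order //; exact: unmovable_top.
by exists (i0 ++ j :: i :: s2), i0, i, j, s2; rewrite add0r in Tt.
Qed.

Lemma ascent_or_sorted w : (exists s i j s', w = s ++ i :: j :: s' /\ (i < j)%N) \/
  sorted (fun i j => j <= i)%N w.
Proof.
elim: w => [|i [|j w] IH]; [by right | by right |].
have [ij|ji] := ltnP i j; first by left; exists [::], i, j, w.
case: IH => [[s [i' [j' [s' [e h]]]]]|sw]; last by right; rewrite /= ji.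
by left; exists (i :: s), i', j', s'; rewrite e.
Qed.

(** At an ascent i, j of the word, the vertex between the two edges is
the left vertex of a translate of the rhombus ij contained in the zonogon (not
necessarily a tile), hence is off the right boundary. *)
Lemma flip_or_inverted w : is_order w -> climbs 0 w ->
  (exists w', flip tile_at w w') \/ (forall i j, i != j -> inverted w i j).
Proof.
move=> ow cw; case: (ascent_or_sorted w) => [[s [i [j [s' [e ij]]]]]|sw].
  left; apply: (movable_flip (a := 1) ow cw e); first by rewrite ler01 lexx.
  have us : uniq (s ++ [:: i; j]).
    by have := is_order_uniq ow; rewrite e -(cat1s i) -(cat1s j) !catA cat_uniq
      -!catA => /andP[].
  have [l [m [l0 m0 ee]]] := east_coord hxi ij.
  have lm : 0 < l + m + 1 by lra.
  have c0 : 0 < (l + m + 1)^-1 by rewrite invr_gt0.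
  have cd : (l + m + 1)^-1 * (l + m + 1) = 1 by rewrite mulVf // gt_eqF.
  set c := (_)^-1 in c0 cd; exists c => //.
  have -> : pt xi s + 1 *: xi i + c *: east R
      = pt xi s + (1 - c * l) *: xi i + (c * m) *: xi j.
    by rewrite ee; apply: plane_eq; rewrite !mxE; ring.
  by apply: zonogon_pt2 => //; nra.
by right=> i j; exact: inverted_of_sorted.
Qed.

End Snakes.

(** * The left boundary is a snake *)

Section LeftBoundary.
Variables (R : realType) (n : nat) (xi : 'I_n -> 'rV[R]_2).
Hypothesis hxi : zonogon_vectors xi.
Variable T : set (tile R n).
Hypothesis hT : rhombus_tiling xi T.
Hypothesis n1 : (1 < n)%N.
Implicit Types (p q v u : 'rV[R]_2) (i j k : 'I_n) (s w : seq 'I_n) (a b c d : R).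
Implicit Types t : tile R n.

Lemma detDr u p q : det u (p + q) = det u p + det u q.
Proof. by rewrite /det !mxE; ring. Qed.

Lemma detZr u a p : det u (a *: p) = a * det u p.
Proof. by rewrite /det !mxE; ring. Qed.

Lemma det_sumr u (f : 'I_n -> 'rV[R]_2) :
  det u (\sum_i f i) = \sum_i det u (f i).
Proof.
apply: (big_morph (det u) (detDr u)).
by rewrite /det !mxE; ring.
Qed.

Lemma mem_enum_prefix s k s' i : enum 'I_n = s ++ k :: s' -> (i \in s) = (i < k)%N.
Proof.
move=> e; have oe : is_order (enum 'I_n) by exact: perm_refl.
by rewrite (@mem_prefix _ s s' i k) -?e // before_enum.
Qed.

(** The linear form det (xi k) is positive on the xi i with i < k and
negative on those with k < i; so its maximum on the zonogon is attained exactly on the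
left boundary edge of color k. *)
Lemma det_left_edge s k s' p : enum 'I_n = s ++ k :: s' -> zonogon xi p ->
  det (xi k) p <= det (xi k) (pt xi s) /\
  (det (xi k) p = det (xi k) (pt xi s) ->
     exists2 c, 0 <= c <= 1 & p = pt xi s + c *: xi k).
Proof.
move=> e [a ha ->].
have us : uniq s by have := enum_uniq 'I_n; rewrite e cat_uniq => /and3P[].
have ept : pt xi s = \sum_(i < n) (i < k)%N%:R *: xi i.
  rewrite /pt big_uniq //= big_mkcond; apply: eq_bigr => i _.
  by rewrite (mem_enum_prefix i e); case: ltnP => _; rewrite ?scale1r ?scale0r.
have ge0 i : true -> 0 <= ((i < k)%N%:R - a i) * det (xi k) (xi i).
  move=> _; have /andP[a0 a1] := ha i; case: (ltngtP i k) => ik.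
  - apply: mulr_ge0; first by rewrite subr_ge0.
    by have := det_lt0 hxi ik; rewrite /det; lra.
  - apply: mulr_le0; first by rewrite sub0r oppr_le0.
    exact/ltW/det_lt0.
  - have -> : i = k by apply/val_inj.
    by rewrite (_ : det _ _ = 0) ?mulr0 // /det; ring.
have ediff : det (xi k) (pt xi s) - det (xi k) (\sum_i a i *: xi i) =
    \sum_(i < n) ((i < k)%N%:R - a i) * det (xi k) (xi i).
  rewrite ept !det_sumr -sumrB; apply: eq_bigr => i _.
  by rewrite !detZr mulrBl.
split; first by rewrite -subr_ge0 ediff sumr_ge0.
move=> h; move: ediff; rewrite h subrr => /esym z.
exists (a k) => //; rewrite ept (bigD1 k) //= [in RHS](bigD1 k) //=.
rewrite ltnn scale0r add0r addrC; congr (_ + _); apply: eq_bigr => i ik.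
congr (_ *: _); have := psumr_eq0P ge0 z (i := i) isT.
move/eqP; rewrite mulf_eq0 subr_eq0 => /orP[/eqP -> //|].
move: ik; rewrite -val_eqE neq_ltn => /orP[] /(det_lt0 hxi); rewrite /det; lra.
Qed.

(** Some tile t contains the lower end v of the boundary edge and a further
point of it.  These are two maxima of det (xi k) on t, so k is a color of t and an edge of
t of color k lies on the line of the boundary edge; it cannot start below v, since t is
contained in the zonogon. *)
Lemma left_edge s k s' : enum 'I_n = s ++ k :: s' ->
  graph_edges xi T (pt xi s, k).
Proof.
move=> e; set v := pt xi s; set phi := det (xi k).
have us : uniq (rcons s k).
  have := enum_uniq 'I_n; rewrite e -cat_rcons cat_uniq => /and3P[//].
have Zv c : 0 <= c <= 1 -> zonogon xi (v + c *: xi k) by exact: zonogon_pt1.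
have [|t Tt acc] := @tile_along_ray _ _ _ _ hT n1 v (xi k).
  by exists 1 => // c /andP[c0 c1]; apply: Zv; rewrite ltW.
have ij := tile_lt hT Tt.
have tv := tile_region_limit hxi hT Tt acc.
have [c [c0 _ tc]] := acc 1 ltr01.
have phik : phi (xi k) = 0 by rewrite /phi /det; ring.
have maxphi p : tile_region xi t p -> phi p <= phi v.
  by move=> tp; apply: (det_left_edge e (tile_zonogon hT n1 Tt tp)).1.
(* A point of t below v on the line of the edge would be a maximum of phi
   outside of the boundary edge. *)
have corner x : 0 <= x -> tile_region xi t (v - x *: xi k) -> x = 0.
  move=> x0 tx.
  have [_] := det_left_edge e (tile_zonogon hT n1 Tt tx).
  case; first by rewrite -scaleNr detDr detZr -/phi phik mulr0 addr0.
  move=> y /andP[y0 _] /addrI/(congr1 (fun p : 'rV[R]_2 => p 0 1)).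
  have yk : xi k 0 1 != 0 by rewrite gt_eqF // xi_gt0.
  by rewrite !mxE -mulNr => /(mulIf yk); lra.
have /tile_regionP[a [b [ha hb ev]]] := tv.
have /tile_regionP[a' [b' [ha' hb' ec]]] := tc.
have tij x y : 0 <= x <= 1 -> 0 <= y <= 1 ->
    tile_region xi t (tile_base t + (x *: xi (tile_lo t) + y *: xi (tile_hi t))).
  by move=> hx hy; apply/tile_regionP; exists x, y.
have phit x y :
    phi (tile_base t + (x *: xi (tile_lo t) + y *: xi (tile_hi t)))
    = phi (tile_base t) + (x * phi (xi (tile_lo t)) + y * phi (xi (tile_hi t))).
  by rewrite /phi !detDr !detZr.
have h0 : 0 <= (0 : R) <= 1 by rewrite lexx ler01.
have h1 : 0 <= (1 : R) <= 1 by rewrite lexx ler01.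
have phiv : phi v = phi (tile_base t)
   + (a * phi (xi (tile_lo t)) + b * phi (xi (tile_hi t))) by rewrite ev phit.
have phic : phi v = phi (tile_base t)
   + (a' * phi (xi (tile_lo t)) + b' * phi (xi (tile_hi t))).
  by rewrite -phit -ec /phi detDr detZr -/phi phik mulr0 addr0.
have max x y (hx : 0 <= x <= 1) (hy : 0 <= y <= 1) := maxphi _ (tij x y hx hy).
suff et : tile_edges xi t (v, k) by apply/graph_edgeP => //; exists t.
have phi_lt i : (i < k)%N -> 0 < phi (xi i).
  by move=> /(det_lt0 hxi); rewrite /phi /det; lra.
have phi_gt i : (k < i)%N -> phi (xi i) < 0.
  by move=> /(det_lt0 hxi); rewrite /phi /det; lra.
have [ek|nk] := eqVneq k (tile_lo t).
  have b0 : b = 0.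
    have := max 0 0 h0 h0; rewrite phit phiv -ek phik.
    have := phi_gt _ (_ : (k < tile_hi t)%N); rewrite {1}ek => /(_ ij).
    by move: hb => /andP[]; nra.
  have a0 : a = 0.
    apply: corner; first by case/andP: ha.
    rewrite ev b0 ek scale0r addr0 addrK.
    by have := tij 0 0 h0 h0; rewrite !scale0r !addr0.
  rewrite ev a0 b0 !scale0r !addr0 ek.
  by case: (t) => ? ? ? /=; left; left; left.
have [ek'|nk'] := eqVneq k (tile_hi t).
  have a1 : a = 1.
    have := max 1 0 h1 h0; rewrite phit phiv -ek' phik.
    have := phi_lt _ (_ : (tile_lo t < k)%N); rewrite {1}ek' => /(_ ij).
    by move: ha => /andP[]; nra.
  have b0 : b = 0.
    apply: corner; first by case/andP: hb.
    rewrite ev a1 ek' scale1r addrA addrK.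
    by have := tij 1 0 h1 h0; rewrite scale0r scale1r addr0.
  rewrite ev a1 b0 scale0r scale1r addr0 ek'.
  by case: (t) => ? ? ? /=; right.
exfalso.
have sgn i : k != i -> phi (xi i) < 0 \/ 0 < phi (xi i).
  by rewrite -val_eqE neq_ltn => /orP[]; [left; exact: phi_gt | right; exact: phi_lt].
(* If k is no color of t, then phi has a unique maximum on t. *)
have extreme (f x : R) : f < 0 \/ 0 < f -> 0 <= x <= 1 -> 0 * f <= x * f ->
    1 * f <= x * f -> x = (0 < f)%R%:R.
  by case=> hf /andP[x0 x1] h_0 h_1; [rewrite (lt_gtF hf) | rewrite hf] => /=; nra.
have a_extreme x y (hx : 0 <= x <= 1) (hy : 0 <= y <= 1) : phi v = phi (tile_base t)
    + (x * phi (xi (tile_lo t)) + y * phi (xi (tile_hi t))) ->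
    x = (0 < phi (xi (tile_lo t)))%R%:R /\ y = (0 < phi (xi (tile_hi t)))%R%:R.
  move=> e1.
  have := max 0 y h0 hy; have := max 1 y h1 hy.
  have := max x 0 hx h0; have := max x 1 hx h1.
  rewrite !phit e1 => m1 m2 m3 m4.
  by split; apply: extreme => //; [exact: sgn | lra | lra | exact: sgn | lra | lra].
have [ea eb] : a = a' /\ b = b'.
  have [-> ->] := a_extreme _ _ ha hb phiv.
  by have [-> ->] := a_extreme _ _ ha' hb' phic.
move: ec; rewrite -ea -eb -ev => /eqP; rewrite addrC -subr_eq0 addrK scaler_eq0.
rewrite gt_eqF //= => /eqP/(congr1 (fun p : 'rV[R]_2 => p 0 1)).
by rewrite mxE => h; have := xi_gt0 hxi k; rewrite h ltxx.
Qed.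

Lemma climbs_alpha : climbs xi T 0 (enum 'I_n).
Proof.
apply: climbs_of_edges => s k s' e; rewrite add0r; exact: left_edge e.
Qed.

End LeftBoundary.

(** * The sweep crosses every tile and never returns *)

Section MovingRight.
Variables (R : realType) (n : nat) (xi : 'I_n -> 'rV[R]_2).
Hypothesis hxi : zonogon_vectors xi.
Implicit Types (p q v u : 'rV[R]_2) (i j k : 'I_n) (s w : seq 'I_n) (a b c d h : R).
Implicit Types t : tile R n.

(** Abscissa of the point of height h on the path with word w from p.  Above its end
the path is continued vertically. *)
Fixpoint path_x p w h : R :=
  if w is k :: w' then
    if h <= (p + xi k) 0 1 then p 0 0 + (h - p 0 1) / xi k 0 1 * xi k 0 0
    else path_x (p + xi k) w' h
  else p 0 0.

Lemma path_x_start p w : path_x p w (p 0 1) = p 0 0.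
Proof.
case: w => //= k w; rewrite mxE lerDl ltW ?xi_gt0 //.
by rewrite subrr !mul0r addr0.
Qed.

Lemma path_x_cat_ge p s w h : (p + pt xi s) 0 1 <= h ->
  path_x p (s ++ w) h = path_x (p + pt xi s) w h.
Proof.
elim: s p => [|k s IH] p; first by rewrite pt_nil addr0.
rewrite pt_cons addrA /= => hp; rewrite -IH //.
case: ifP => // hk.
have -> : h = (p + xi k) 0 1.
  apply/eqP; rewrite eq_le hk /=; apply: le_trans hp.
  by rewrite [leRHS]mxE lerDl pt_ge0.
rewrite path_x_start !mxE; have yk : xi k 0 1 != 0 by rewrite gt_eqF // xi_gt0.
by field.
Qed.

Lemma path_x_cat_le p s w w' h : p 0 1 <= h <= (p + pt xi s) 0 1 ->
  path_x p (s ++ w) h = path_x p (s ++ w') h.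
Proof.
elim: s p => [|k s IH] p.
  by rewrite pt_nil addr0 -eq_le /= => /eqP <-; rewrite !path_x_start.
rewrite pt_cons addrA /= => /andP[ph hp]; case: leP => // /ltW hk.
by apply: IH; rewrite hk.
Qed.

Lemma path_x_vertex p s w :
  path_x p (s ++ w) ((p + pt xi s) 0 1) = (p + pt xi s) 0 0.
Proof. by rewrite path_x_cat_ge // path_x_start. Qed.

(** All points q at height h are compared at once with the path, through the
horizontal vector that joins them to it. *)
Lemma path_x_on p w h : w != [::] -> p 0 1 <= h <= (p + pt xi w) 0 1 ->
  exists s k s' a, [/\ w = s ++ k :: s', 0 <= a <= 1 & forall q, q 0 1 = h ->
    q = p + pt xi s + a *: xi k + (q 0 0 - path_x p w h) *: east R].
Proof.
elim: w p => // k w IH p _ /andP[ph]; rewrite pt_cons addrA /= => hp.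
have yk := xi_gt0 hxi k.
case: leP => hk.
  exists [::], k, w, ((h - p 0 1) / xi k 0 1); split => //.
    rewrite divr_ge0 ?subr_ge0 // ?(ltW yk) //= ler_pdivrMr // mul1r.
    by move: hk; rewrite mxE; lra.
  move=> q eq_; have ykn : xi k 0 1 != 0 by rewrite gt_eqF.
  rewrite pt_nil addr0; apply: plane_eq; rewrite !mxE /=; first by ring.
  by rewrite eq_; field.
case: w IH hp => [_|l w IH hp].
  by rewrite pt_nil addr0 leNgt hk.
have [|s [k' [s' [a [e ha hq]]]]] := IH (p + xi k) isT.
  by rewrite ltW.
exists (k :: s), k', s', a; split => //; first by rewrite e.
by rewrite pt_cons addrA.
Qed.

(** The coordinates a, b refer to the parallelogram spanned by the two
steps: the path passes along its sides b = 0 and then a = 1. *)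
Lemma path_x_two_steps s i j s' h :
    (pt xi s) 0 1 <= h <= (pt xi s + xi i + xi j) 0 1 ->
  exists a b, [/\ 0 <= a <= 1, 0 <= b <= 1, b = 0 \/ a = 1 & forall q, q 0 1 = h ->
    q = pt xi s + (a *: xi i + b *: xi j)
        + (q 0 0 - path_x 0 (s ++ i :: j :: s') h) *: east R].
Proof.
move=> /andP[h0 h1].
rewrite path_x_cat_ge add0r // (@path_x_cat_le _ [:: i; j] s' [::]); last first.
  by rewrite !pt_cons pt_nil addr0 addrA h0.
have [//||u [k [u' [c [e hc hq]]]]] := @path_x_on (pt xi s) [:: i; j] h.
  by rewrite !pt_cons pt_nil addr0 addrA h0.
have z01 : 0 <= (0 : R) <= 1 by rewrite lexx ler01.
have o01 : 0 <= (1 : R) <= 1 by rewrite lexx ler01.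
case: u e hq => [[<- _]|l [|l' u]].
- rewrite pt_nil addr0 => hq; exists c, 0; split; auto.
  by move=> q /hq; rewrite scale0r addr0.
- move=> [<- <- _]; rewrite pt_cons pt_nil addr0 => hq; exists 1, c; split; auto.
  by move=> q /hq; rewrite scale1r addrA.
- by case: u.
Qed.

Lemma flip_path_x_out s i j s' h : 0 <= h ->
    ~~ ((pt xi s) 0 1 <= h <= (pt xi s + xi i + xi j) 0 1) ->
  path_x 0 (s ++ i :: j :: s') h = path_x 0 (s ++ j :: i :: s') h.
Proof.
move=> h0; rewrite negb_and -!ltNge => /orP[hl|hr].
  by apply: path_x_cat_le; rewrite add0r mxE h0 ltW.
have cat2 (x y : 'I_n) : s ++ x :: y :: s' = (s ++ [:: x; y]) ++ s' by rewrite -catA.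
rewrite !cat2.
have e : pt xi (s ++ [:: i; j]) = pt xi s + xi i + xi j.
  by rewrite pt_cat !pt_cons pt_nil addr0 addrA.
have e' : pt xi (s ++ [:: j; i]) = pt xi s + xi i + xi j.
  by rewrite pt_cat !pt_cons pt_nil addr0 (addrC (xi j)) addrA.
by rewrite !path_x_cat_ge; rewrite !add0r ?e ?e' // ltW.
Qed.

(** Write the two points at height h in the coordinates of the tile; as
they differ by a multiple of the horizontal vector, comparing coordinates gives the sign of
this multiple. *)
Lemma flip_path_x_le s i j s' h : (i < j)%N -> 0 <= h ->
  path_x 0 (s ++ i :: j :: s') h <= path_x 0 (s ++ j :: i :: s') h.
Proof.
move=> ij h0.
case: (boolP ((pt xi s) 0 1 <= h <= (pt xi s + xi i + xi j) 0 1)) => hb; last first.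
  by rewrite (@flip_path_x_out s i j).
have [a [b [/andP[a0 a1] /andP[b0 b1] hab hl]]] := @path_x_two_steps s i j s' h hb.
have hb' : (pt xi s) 0 1 <= h <= (pt xi s + xi j + xi i) 0 1 by rewrite addrAC.
have [b' [a' [/andP[b'0 b'1] /andP[a'0 a'1] hab' hr]]] :=
  @path_x_two_steps s j i s' h hb'.
have [l [m [l0 m0 ee]]] := east_coord hxi ij.
set x := path_x 0 _ h in hl *; set x' := path_x 0 _ h in hr *.
pose q : 'rV[R]_2 := \row_r (if r == 0 then x' else h).
have [q0 q1] : q 0 0 = x' /\ q 0 1 = h by rewrite !mxE.
have := hl q q1; rewrite {1}(hr q q1) q0 subrr scale0r addr0 ee -addrA => /addrI e.
have [] := @tile_coord_inj _ _ _ hxi i j a' b' (a - (x' - x) * l) (b + (x' - x) * m) ij.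
  rewrite addrC e; apply: plane_eq; rewrite !mxE; ring.
rewrite -subr_ge0; case: hab hab' => [->|->] [->|->] e1 e2.
- by rewrite -(pmulr_lge0 _ l0); lra.
- by rewrite -(pmulr_lge0 _ m0); lra.
- by rewrite -(pmulr_lge0 _ l0); lra.
- by rewrite -(pmulr_lge0 _ l0); lra.
Qed.

(** The new path passes along the sides a = 0 and b = 1 of the tile, away
from the left vertex, which has coordinates (1, 0). *)
Lemma flip_left_vertex s i j s' : (i < j)%N ->
  (pt xi s + xi i) 0 0 < path_x 0 (s ++ j :: i :: s') ((pt xi s + xi i) 0 1).
Proof.
move=> ij; have yi := xi_gt0 hxi i; have yj := xi_gt0 hxi j.
have hb' : (pt xi s) 0 1 <= (pt xi s + xi i) 0 1 <= (pt xi s + xi j + xi i) 0 1.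
  by rewrite !mxE; lra.
have [b [a [/andP[b0 b1] /andP[a0 a1] hab]]] := path_x_two_steps s' hb'.
have [l [m [l0 m0 ee]]] := east_coord hxi ij.
move=> /(_ _ erefl); set d := _ - path_x _ _ _ => e.
rewrite -subr_lt0 -/d; move: e; rewrite -addrA ee => /addrI e.
have [] := @tile_coord_inj _ _ _ hxi i j 1 0 (a - d * l) (b + d * m) ij.
  by rewrite scale1r scale0r addr0 {1}e; apply: plane_eq; rewrite !mxE; ring.
case: hab => -> e1 e2.
- by rewrite -(pmulr_llt0 _ l0); lra.
- by rewrite -(pmulr_llt0 _ m0); lra.
Qed.

Lemma flip_between s i j s' p : (i < j)%N -> 0 <= p 0 1 ->
    path_x 0 (s ++ i :: j :: s') (p 0 1) <= p 0 0 ->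
    p 0 0 < path_x 0 (s ++ j :: i :: s') (p 0 1) ->
  tile_region xi (Tile i j (pt xi s)) p.
Proof.
move=> ij p0 hl hr.
case: (boolP ((pt xi s) 0 1 <= p 0 1 <= (pt xi s + xi i + xi j) 0 1)) => hb; last first.
  by move: hl hr; rewrite (@flip_path_x_out s i j) //; lra.
have hb' : (pt xi s) 0 1 <= p 0 1 <= (pt xi s + xi j + xi i) 0 1 by rewrite addrAC.
have [a [b [/andP[a0 a1] /andP[b0 b1] _]]] := path_x_two_steps s' hb.
have [b' [a' [/andP[b'0 b'1] /andP[a'0 a'1] _]]] := path_x_two_steps s' hb'.
have [l [m [l0 m0 ee]]] := east_coord hxi ij.
move=> /(_ _ erefl) e' /(_ _ erefl) e; move: e e'.
rewrite -subr_ge0 in hl; rewrite -subr_lt0 in hr.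
set d := p 0 0 - _ in hl *; set d' := p 0 0 - _ in hr * => e e'.
have dl : 0 <= d * l by rewrite mulr_ge0 // ltW.
have dm : 0 <= d * m by rewrite mulr_ge0 // ltW.
have d'l : d' * l <= 0 by rewrite ltW // pmulr_llt0.
have d'm : d' * m <= 0 by rewrite ltW // pmulr_llt0.
have ep : p = pt xi s + ((a - d * l) *: xi i + (b + d * m) *: xi j).
  by rewrite {1}e ee; apply: plane_eq; rewrite !mxE; ring.
have ep' : p = pt xi s + ((a' - d' * l) *: xi i + (b' + d' * m) *: xi j).
  by rewrite {1}e' ee; apply: plane_eq; rewrite !mxE; ring.
have [e1 e2] := tile_coord_inj hxi ij (addrI _ (etrans (esym ep) ep')).
apply/tile_regionP; exists (a - d * l), (b + d * m).
by split; [lra | lra | exact: ep].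
Qed.

Variable T : set (tile R n).
Hypothesis hT : rhombus_tiling xi T.
Hypothesis n1 : (1 < n)%N.

Lemma zonogon_height p : zonogon xi p -> 0 <= p 0 1 <= (zonogon_top xi) 0 1.
Proof.
have ge0 q : zonogon xi q -> 0 <= q 0 1.
  move=> [a ha ->]; rewrite summxE sumr_ge0 // => i _; rewrite mxE.
  by rewrite mulr_ge0 ?(ltW (xi_gt0 hxi i)) //; case/andP: (ha i).
move=> Zp; rewrite ge0 //=; have := ge0 _ (zonogon_sym Zp).
by rewrite !mxE subr_ge0.
Qed.

Lemma path_x_order w p : is_order w -> zonogon xi p ->
  exists s k s' a, [/\ w = s ++ k :: s', 0 <= a <= 1 &
    p = pt xi s + a *: xi k + (p 0 0 - path_x 0 w (p 0 1)) *: east R].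
Proof.
move=> ow Zp; have /andP[h0 h1] := zonogon_height Zp.
have wn : w != [::].
  by rewrite -size_eq0; have [_ ->] := elimT (is_orderP w) ow; case: (n) n1.
have [|s [k [s' [a [e ha hp]]]]] := @path_x_on 0 w (p 0 1) wn.
  by rewrite add0r (pt_order _ ow) h1 mxE h0.
by exists s, k, s', a; split => //; rewrite -[pt xi s]add0r; exact: hp.
Qed.

(** The point of alpha at the height of p lies on the edge of some color k;
further to the left, the form det (xi k) exceeds its maximum on the zonogon. *)
Lemma path_x_alpha p : zonogon xi p -> path_x 0 (enum 'I_n) (p 0 1) <= p 0 0.
Proof.
move=> Zp; have [s [k [s' [a [e _]]]]] := path_x_order (perm_refl _) Zp.
set d := _ - _ => ep; rewrite -subr_ge0 -/d.
have [] := det_left_edge hxi e Zp; rewrite ep !detDr !detZr => + _.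
rewrite (_ : det (xi k) (xi k) = 0) ?mulr0 ?addr0; last by rewrite /det; ring.
rewrite (_ : det (xi k) (east R) = - xi k 0 1); last by rewrite /det !mxE /=; ring.
have := xi_gt0 hxi k; rewrite gerDl mulrN oppr_le0 => yk.
by rewrite pmulr_lge0.
Qed.

(** A snake that cannot be pushed further to the right runs along the right
boundary. *)
Lemma path_x_last w p : is_order w -> climbs xi T 0 w ->
    (forall w', ~ flip (tile_at xi T) w w') -> zonogon xi p -> movable xi p ->
  p 0 0 < path_x 0 w (p 0 1).
Proof.
move=> ow cw nf Zp [c c0 Zc]; rewrite ltNge -subr_ge0; apply/negP.
have [s [k [s' [a [e ha]]]]] := path_x_order ow Zp.
set d := _ - _ => ep d0.
have [|w' ww'] := movable_flip hxi hT n1 ow cw e ha; last exact: nf ww'.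
exists (d + c); first by rewrite ltr_wpDl.
by rewrite scalerDl addrA -ep.
Qed.

Variables (N : nat) (W : nat -> seq 'I_n).
Hypothesis sweepW : sweep (tile_at xi T) N W.
Hypothesis climbsW : forall m, (m <= N)%N -> climbs xi T 0 (W m).

(** The center of the tile is to the right of alpha and to the left of omega, so
some flip passes over it; the tile of this flip contains the center. *)
Lemma tile_swept t : T t -> exists m s s', [/\ (m < N)%N, tile_base t = pt xi s,
  W m = s ++ tile_lo t :: tile_hi t :: s' &
  W m.+1 = s ++ tile_hi t :: tile_lo t :: s'].
Proof.
move=> Tt; pose c := tile_base t + (2^-1 *: xi (tile_lo t) + 2^-1 *: xi (tile_hi t)).
have ij := tile_lt hT Tt.
have tc : tile_region xi t c.
  by apply/tile_regionP; exists 2^-1, 2^-1; split => //; lra.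
have Zc := tile_zonogon hT n1 Tt tc.
have mc : movable xi c.
  have [l [m [l0 m0 ee]]] := east_coord hxi ij.
  (* Small enough for both coordinates to stay in [0, 1]. *)
  have lm : 0 < (l + m) * 2 by lra.
  exists ((l + m) * 2)^-1; first by rewrite invr_gt0.
  have e1 : ((l + m) * 2)^-1 * ((l + m) * 2) = 1 by rewrite mulVf // gt_eqF.
  have d0 : 0 < ((l + m) * 2)^-1 by rewrite invr_gt0.
  set d := (_)^-1 in e1 d0 *.
  apply: (tile_zonogon hT n1 Tt); apply/tile_regionP.
  exists (2^-1 - d * l), (2^-1 + d * m); split; [nra | nra |].
  by rewrite /c ee; apply: plane_eq; rewrite !mxE; ring.
have /andP[c0 _] := zonogon_height Zc.
have lastN : c 0 0 < path_x 0 (W N) (c 0 1).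
  have oN := sweep_is_order sweepW (leqnn N).
  apply: path_x_last => //; first exact: climbsW.
  by move=> w'; apply: no_flip_inverted => //; case: sweepW.
have [m [mN cl cr]] : exists m, [/\ (m < N)%N, path_x 0 (W m) (c 0 1) <= c 0 0
    & c 0 0 < path_x 0 (W m.+1) (c 0 1)].
  have first0 : path_x 0 (W 0) (c 0 1) <= c 0 0.
    by case: sweepW => -> _ _; exact: path_x_alpha.
  move: lastN; move: {1 3}N (leqnn N) => M.
  elim: M => [|M IH] MN; first by rewrite ltNge first0.
  case: (leP (path_x 0 (W M) (c 0 1)) (c 0 0)) => [hM hM'|hM _].
    by exists M.
  exact: (IH (ltnW MN)).
case: sweepW => _ /(_ m mN)[s [i [j [s' [lij Tij e e']]]]] _.
rewrite e in cl; rewrite e' in cr.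
have et : t = Tile i j (pt xi s).
  by apply: (tile_eq_of_interior hxi hT Tt Tij (a := 2^-1) (b := 2^-1));
    [lra | lra | exact: (flip_between lij c0 cl cr)].
by exists m, s, s'; rewrite et.
Qed.

Lemma edge_swept p k : graph_edges xi T (p, k) -> exists m s s',
  [/\ (m <= N)%N, W m = s ++ k :: s' & pt xi s = p].
Proof.
move=> /(graph_edgeP xi T n1)[t Tt].
have [m [s [s' [mN]]]] := tile_swept Tt; case: t Tt => i j q /= _ -> e e'.
case=> [[[|]|]|] [-> ->].
- by exists m, s, (j :: s'); rewrite ltnW.
- by exists m.+1, s, (i :: s').
- by exists m.+1, (s ++ [:: j]), s'; rewrite -catA pt_cat pt_cons pt_nil addr0.
- by exists m, (s ++ [:: i]), s'; rewrite ltnW // -catA pt_cat pt_cons pt_nil addr0.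
Qed.

Lemma sweep_path_x_mono m m' h : 0 <= h -> (m <= m')%N -> (m' <= N)%N ->
  path_x 0 (W m) h <= path_x 0 (W m') h.
Proof.
move=> h0; elim: m' => [|m' IH]; first by rewrite leqn0 => /eqP ->.
rewrite leq_eqVlt => /orP[/eqP -> //|mm' m'N].
apply: le_trans (IH mm' (ltnW m'N)) _.
case: sweepW => _ /(_ m' m'N)[s [i [j [s' [lij _ -> ->]]]]] _.
exact: flip_path_x_le.
Qed.

(** Heights increase strictly along a path. *)
Lemma prefix_inj s1 s2 s1' s2' : s1 ++ s2 = s1' ++ s2' ->
  (pt xi s1) 0 1 = (pt xi s1') 0 1 -> s1 = s1'.
Proof.
elim: s1 s1' => [|k s1 IH] [|k' s1'] //=.
- move=> _; rewrite pt_cons pt_nil !mxE => h.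
  by exfalso; have := xi_gt0 hxi k'; have := pt_ge0 hxi s1'; lra.
- move=> _; rewrite pt_cons pt_nil !mxE => h.
  by exfalso; have := xi_gt0 hxi k; have := pt_ge0 hxi s1; lra.
- move=> [-> e]; rewrite !pt_cons [LHS]mxE [RHS]mxE => /addrI h.
  by rewrite (IH s1' e h).
Qed.

(** A flip removes a single vertex from the path; all others keep their sets of
colors.  The removed one is then strictly to the left of the path, and stays so. *)
Lemma vertex_persists m m' s1 s2 : (m <= m')%N -> (m' <= N)%N -> W m = s1 ++ s2 ->
  (exists s1' s2', W m' = s1' ++ s2' /\ perm_eq s1' s1) \/
  (pt xi s1) 0 0 < path_x 0 (W m') ((pt xi s1) 0 1).
Proof.
elim: m' => [|m' IH].
  by rewrite leqn0 => /eqP -> _ e; left; exists s1, s2.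
rewrite leq_eqVlt => /orP[/eqP -> _ e|mm' m'N e]; first by left; exists s1, s2.
have [[u1 [u2 [eu pu]]]|lt] := IH mm' (ltnW m'N) e; last first.
  right; apply: lt_le_trans lt _; apply: sweep_path_x_mono => //.
  exact: pt_ge0.
case: sweepW => _ /(_ m' m'N)[s [i [j [s' [lij _ em em']]]]] _.
rewrite eu in em.
have [sz|sz] := leqP (size u1) (size s).
  left; exists u1, (drop (size u1) s ++ j :: i :: s'); split => //.
  rewrite em' catA; congr (_ ++ _).
  have := congr1 (take (size u1)) em.
  rewrite take_size_cat // takel_cat // => e1.
  by rewrite -[LHS](cat_take_drop (size u1)) -e1.
have es : s = take (size s) u1.
  by have := congr1 (take (size s)) em; rewrite [RHS]take_size_cat // takel_cat // ltnW.
rewrite -(cat_take_drop (size s) u1) -es -catA in em pu.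
move: em => /(congr1 (drop (size s))); rewrite !drop_size_cat //.
have : (0 < size (drop (size s) u1))%N by rewrite size_drop subn_gt0.
case: (drop _ _) pu => [|x [|y v]] //= pu _.
  move=> [ex _]; right.
  rewrite -(pt_perm xi pu) pt_cat pt_cons pt_nil addr0 ex em'.
  exact: flip_left_vertex.
move=> [ex ey ev]; rewrite ex ey in pu; left; exists (s ++ [:: j, i & v]), u2.
rewrite em' -ev -catA; split => //.
apply: perm_trans pu; rewrite perm_cat2l.
by rewrite (perm_catCA [:: j] [:: i] v).
Qed.

(** If the sweep meets the vertex at times m <= m', it has not been left
behind in between, so it has kept its set of colors. *)
Lemma vertex_label_uniq m m' s1 s2 s1' s2' : (m <= N)%N -> (m' <= N)%N ->
    W m = s1 ++ s2 -> W m' = s1' ++ s2' -> pt xi s1 = pt xi s1' ->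
  perm_eq s1 s1'.
Proof.
move=> mN m'N; wlog mm' : m m' s1 s2 s1' s2' mN m'N / (m <= m')%N.
  move=> H e e' ept; case: (leqP m m') => [mm'|/ltnW mm']; first exact: H e e' ept.
  by rewrite perm_sym; exact: H e' e (esym ept).
move=> e e' ept.
have [[u1 [u2 [eu pu]]]|] := vertex_persists mm' m'N e.
  rewrite perm_sym -(@prefix_inj u1 u2 s1' s2') -?eu //.
  by rewrite (pt_perm xi pu) ept.
have := path_x_vertex 0 s1' s2'.
by rewrite add0r e' ept => ->; rewrite ltxx.
Qed.

(** By induction along w: the next edge of w lies on some W m, and there its
lower vertex carries the set of colors already found, by uniqueness of the labels. *)
Lemma prefix_swept w s1 s2 : climbs xi T 0 w -> w = s1 ++ s2 ->
  exists m (u1 u2 : seq 'I_n), [/\ (m <= N)%N, W m = u1 ++ u2 & perm_eq u1 s1].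
Proof.
move=> cw; elim/last_ind: s1 s2 => [|s k IH] s2 ew.
  by exists 0%N, [::], (W 0).
rewrite cat_rcons in ew; have [m0 [v1 [v2 [m0N ev pv]]]] := IH _ ew.
have Ge : graph_edges xi T (pt xi s, k).
  by have := @climbs_edge _ _ xi T 0 s k s2; rewrite add0r -ew; apply.
have [m [u [u2 [mN eu epu]]]] := edge_swept Ge.
exists m, (rcons u k), u2; rewrite cat_rcons; split => //.
rewrite -!cats1 perm_cat2r; apply: (perm_trans _ pv).
by apply: (vertex_label_uniq mN m0N eu ev); rewrite epu (pt_perm xi pv).
Qed.

End MovingRight.

(** * Compatible orders *)

Section LinearOrders.
Variable n : nat.
Implicit Types (x : linorder n) (w : seq 'I_n) (a b c i j k : 'I_n).

Lemma word_is_order x : is_order (word x).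
Proof. by apply/is_orderP; rewrite size_tuple; split=> //; exact: (valP x). Qed.

Lemma is_order_word w : is_order w -> exists x, word x = w.
Proof.
move=> /is_orderP[uw /eqP sw].
by exists (exist (fun w : n.-tuple 'I_n => uniq w) (Tuple sw) uw).
Qed.

(** Both sides say that the restricted word is sorted for the order of
x. *)
Lemma restriction_chain (A : seq 'I_n) x a b c :
    uniq A -> perm_eq [:: a; b; c] A ->
  order_restriction A x = [:: a; b; c] <-> chain (word x) a b c.
Proof.
move=> uA eA; have ow := word_is_order x.
have sw : sorted (before (word x)) (order_restriction A x).
  exact: (sorted_filter (@before_trans _ (word x)) _ (before_sorted ow)).
split=> [e|ch]; first by move: sw; rewrite e /= andbT.
apply: (irr_sorted_eq (@before_trans _ (word x))) => //.
- by move=> l; rewrite /before ltnn.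
- by rewrite /= andbT.
- by move=> l; rewrite mem_filter (perm_mem eA) (is_order_mem l ow) andbT.
Qed.

End LinearOrders.

Section CompatibleWords.
Variables (R : realType) (n : nat) (xi : 'I_n -> 'rV[R]_2) (T : set (tile R n)).

Lemma directed_path_climbs p s q :
  directed_path xi (graph_edges xi T) p s q -> climbs xi T p [seq e.2 | e <- s].
Proof. by elim: s p => //= -[p' k] s IH p /= [-> Ge /IH]. Qed.

Lemma climbs_directed_path p w : climbs xi T p w -> exists2 s,
  directed_path xi (graph_edges xi T) p s (p + pt xi w) & [seq e.2 | e <- s] = w.
Proof.
elim: w p => [|k w IH] p /=; first by exists [::]; rewrite //= pt_nil addr0.
move=> [Ge /IH[s ds es]]; exists ((p, k) :: s); rewrite /= ?es //.
by rewrite pt_cons addrA.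
Qed.

Lemma compatibleP (x : linorder n) :
  compatible_orders xi T x <-> climbs xi T 0 (word x).
Proof.
split=> [[s /directed_path_climbs h <-] //|/climbs_directed_path[s]].
by rewrite add0r pt_order ?word_is_order // => ds es; exists s.
Qed.

Lemma acyclic_le1 (D : set (linorder n)) :
  (n <= 1)%N -> ~ cyclic_domain D.
Proof.
move=> n1 [i [j [k [u _]]]].
have := uniq_leq_size u (fun l _ => mem_enum 'I_n l).
by rewrite size_enum_ord /=; lia.
Qed.

End CompatibleWords.

Lemma restrictions_chains n (i j k : 'I_n) (x y z : linorder n) :
    uniq [:: i; j; k] -> let r := order_restriction [:: i; j; k] in
  ([/\ r x = [:: i; j; k], r y = [:: j; k; i] & r z = [:: k; i; j]] <->
   [/\ chain (word x) i j k, chain (word y) j k i & chain (word z) k i j]) /\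
  ([/\ r x = [:: k; j; i], r y = [:: j; i; k] & r z = [:: i; k; j]] <->
   [/\ chain (word x) k j i, chain (word y) j i k & chain (word z) i k j]).
Proof.
move=> u; have rc w a b c (e : perm_eq [:: a; b; c] [:: i; j; k]) :=
  restriction_chain w u e.
have p a b c : (forall P : pred 'I_n,
   P a + (P b + (P c + 0)) = P i + (P j + (P k + 0)))%N ->
   perm_eq [:: a; b; c] [:: i; j; k] by move=> h; apply/permP.
by split; (split=> -[h1 h2 h3]; split; apply/rc => //; apply: p => P; lia).
Qed.

Section CompleteDomain.
Variables (R : realType) (n : nat) (xi : 'I_n -> 'rV[R]_2).
Hypothesis hxi : zonogon_vectors xi.
Variable T : set (tile R n).
Hypothesis hT : rhombus_tiling xi T.

(** All linear orders are compatible, and no three different colors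
exist. *)
Lemma complete_one_color : n = 1%N -> complete_condorcet_domain (compatible_orders xi T).
Proof.
move=> n1.
have all x : compatible_orders xi T x.
  apply/compatibleP; have ow := word_is_order x.
  have [_ sz] := elimT (is_orderP _) ow; have {sz}: size (word x) = 1%N by rewrite sz.
  case: (word x) => [//|k [|//]] _ /=; split => //.
  by right.
split=> [|x nx]; last by have := nx (all x).
split; [exact: all | exact: all |].
by apply: acyclic_le1; rewrite n1.
Qed.

(** The compatible orders are the obedient ones. *)
Lemma complete_many_colors : (1 < n)%N ->
  complete_condorcet_domain (compatible_orders xi T).
Proof.
move=> n1.
have climbs_flip w w' : climbs xi T 0 w -> flip (tile_at xi T) w w' ->
    climbs xi T 0 w'.
  move=> cw [s [i [j [s' [ij Tt e ->]]]]]; rewrite e in cw.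
  by apply: climbs_swap cw; rewrite add0r.
have [N [W [sweepW climbsW]]] := sweep_exists (climbs_alpha hxi hT n1) climbs_flip
  (flip_or_inverted hxi hT n1).
have ob w : is_order w -> climbs xi T 0 w -> obedient N W w.
  move=> ow cw; apply: (obedient_of_prefixes sweepW ow) => s1 s2.
  exact: (prefix_swept hxi hT n1 sweepW climbsW cw).
have climbs_ob w : is_order w -> obedient N W w -> climbs xi T 0 w.
  apply: (obedient_ind sweepW (climbs_alpha hxi hT n1)).
  move=> s1 s1' i j s2 _ Tt ps; apply: climbs_swap.
  by rewrite add0r -(pt_perm xi ps).
have compatW m : (m <= N)%N -> forall x, word x = W m -> compatible_orders xi T x.
  by move=> mN x e; apply/compatibleP; rewrite e; exact: climbsW.
have walpha : word (alpha n) = W 0 by case: sweepW => -> _ _; exact: val_ord_tuple.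
have womega : word (omega n) = W N.
  apply: before_inj; [exact: word_is_order | exact: (sweep_is_order sweepW) |].
  move=> a b; have [->|ab] := eqVneq a b; first by rewrite /before !ltnn.
  have [_ _ /(_ a b ab) inv] := sweepW; rewrite !beforeE inv /=.
  by rewrite -[word _]/(rev (ord_tuple n)) val_ord_tuple inverted_rev_enum.
split; first split.
- exact: (compatW 0%N).
- exact: (compatW N).
- move=> [i [j [k [u [x [y [z [[cx cy cz] r]]]]]]]].
  have obs v : compatible_orders xi T v -> obedient N W (word v).
    by move=> /compatibleP; exact/ob/word_is_order.
  have ox := word_is_order x; have oy := word_is_order y; have oz := word_is_order z.
  have [c1 c2] := restrictions_chains x y z u.
  case: r => [/c1|/c2].
    exact: (obedient_acyclic sweepW u ox oy oz (obs _ cx) (obs _ cy) (obs _ cz)).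
  have u' : uniq [:: k; j; i] by move: u; rewrite -rev_uniq.
  exact: (obedient_acyclic sweepW u' ox oy oz (obs _ cx) (obs _ cy) (obs _ cz)).
move=> x nx.
have nob : ~ obedient N W (word x).
  by move=> obx; apply/nx/compatibleP/climbs_ob => //; exact: word_is_order.
have [i [j [k [u [w1 [w2 [w3 [[D1 D2 D3] pat]]]]]]]] :=
  disobedient_cyclic sweepW (word_is_order x) nob.
exists i, j, k; split => //.
have lin w : w = word x \/ (exists2 m, (m <= N)%N & w = W m) ->
    exists2 y, (x |` compatible_orders xi T) y & word y = w.
  case=> [->|[m mN ->]]; first by exists x => //; left.
  have [y ey] := is_order_word (sweep_is_order sweepW mN).
  by exists y => //; right; exact: compatW ey.
have [y1 Dy1 e1] := lin _ D1; have [y2 Dy2 e2] := lin _ D2.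
have [y3 Dy3 e3] := lin _ D3.
exists y1, y2, y3; split => //=; rewrite -e1 -e2 -e3 in pat.
have [c1 c2] := restrictions_chains y1 y2 y3 u.
by case: pat => [/c1|/c2]; [left | right].
Qed.

End CompleteDomain.

Theorem theorem1 (R : realType) (n : nat) (hn : (1 <= n)%N)
    (xi : 'I_n -> 'rV[R]_2) (hxi : zonogon_vectors xi)
    (T : set (tile R n)) (hT : rhombus_tiling xi T) :
  complete_condorcet_domain (compatible_orders xi T).
Proof.
move: (hn); rewrite leq_eqVlt => /orP[/eqP/esym n1|n1].
  exact: complete_one_color.
exact: complete_many_colors.
Qed.
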